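(* Let $P_c(\mathbb{R})$ be the set of continuous Borel probability measures on $\mathbb{R}$ and let $\phi\colon P_c(\mathbb{R})\to P_c(\mathbb{R})$ be a surjective map which is an isometry with respect to the Kuiper distance, i.e. $d_{Ku}(\phi(\mu),\phi(\nu))=d_{Ku}(\mu,\nu)$ for all $\mu,\nu\in P_c(\mathbb{R})$. Then there exist a homeomorphism $g\colon\mathbb{R}\to\mathbb{R}$ and an $x\in\mathbb{R}\cup\{\infty\}$ such that $$\phi(\mu)=\mu\circ(g\circ r_x)\qquad(\mu\in P_c(\mathbb{R})).$$ Moreover, every transformation of this form (with $g$ a homeomorphism of $\mathbb{R}$ and $x\in\mathbb{R}\cup\{\infty\}$) is a surjective isometry of $P_c(\mathbb{R})$ with respect to the Kuiper distance.
   Context: A Borel probability measure $\mu$ on $\mathbb{R}$ is continuous if $\mu(\{t\})=0$ for every $t\in\mathbb{R}$. For Borel probability measures $\mu,\nu$ on $\mathbb{R}$ with distribution functions $f_\mu(t)=\mu((-\infty,t])$, the Kuiper distance is $d_{Ku}(\mu,\nu)=\sup_{t}(f_\mu(t)-f_\nu(t))+\sup_t(f_\nu(t)-f_\mu(t))$, which equals $\sup\{|\mu(I)-\nu(I)|: I\subseteq\mathbb{R}\text{ a non-degenerate interval}\}$. For $x\in\mathbb{R}$, $r_x\colon\mathbb{R}\setminus\{x\}\to\mathbb{R}$ is $r_x(t)=1/(t-x)$, and $r_\infty\colon\mathbb{R}\to\mathbb{R}$ is the identity. If $A$ is a Borel set and $G\colon A\to\mathbb{R}$ is injective and maps Borel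 sets to Borel sets, then $\mu\circ G$ denotes the Borel measure $(\mu\circ G)(B)=\mu(G(B\cap A))$ for Borel $B\subseteq\mathbb{R}$. *)

(* Defs.v *)
(* R : realType carries its canonical Borel
   sigma-algebra (generated by the intervals ]a,b]), see lebesgue_stieltjes_measure. *)
From HB Require Import structures.
From mathcomp Require Import all_boot all_order all_algebra.
From mathcomp Require Import all_classical all_reals all_analysis.
Set Implicit Arguments. Unset Strict Implicit. Unset Printing Implicit Defensive.
Import Order.TTheory GRing.Theory Num.Theory.
Import numFieldNormedType.Exports.
Local Open Scope classical_set_scope.
Local Open Scope ring_scope.

Section Defs.
Variable R : realType.

Definition continuous_prob (mu : probability R R) : Prop :=
  forall t : R, mu [set t] = 0%E.

Record Pc := MkPc { pc_meas :> probability R R ; pc_cont : continuous_prob pc_meas }.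

Definition distrf (mu : probability R R) (t : R) : R := fine (mu [set` `]-oo, t]]).

Definition d_Ku (mu nu : probability R R) : R :=
  sup [set distrf mu t - distrf nu t | t in [set: R]] +
  sup [set distrf nu t - distrf mu t | t in [set: R]].

(* r_x for x in R u {oo}: None encodes oo (r_oo = identity on R);
   Some x encodes r_x(t) = 1/(t - x) on R \ {x}. *)
Definition dom_r (x : option R) : set R :=
  match x with None => [set: R] | Some a => ~` [set a] end.
Definition r_ (x : option R) (t : R) : R :=
  match x with None => t | Some a => (t - a)^-1 end.

(* (mu o G)(B) = mu(G(B n A)) for G = g o r_x with domain A = dom_r x *)
Definition comp_set (g : R -> R) (x : option R) (B : set R) : set R :=
  (g \o r_ x) @` (B `&` dom_r x).

Definition homeomorphism (g : R -> R) : Prop :=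
  exists h : R -> R, cancel g h /\ cancel h g /\ continuous g /\ continuous h.

Definition is_comp_map (phi : Pc -> Pc) (g : R -> R) (x : option R) : Prop :=
  forall (mu : Pc) (B : set R), measurable B ->
    (phi mu : probability R R) B = (mu : probability R R) (comp_set g x B).

Definition surjective_Pc (phi : Pc -> Pc) : Prop :=
  forall nu : Pc, exists mu : Pc, phi mu = nu.

Definition Ku_isometry (phi : Pc -> Pc) : Prop :=
  forall mu nu : Pc, d_Ku (phi mu) (phi nu) = d_Ku mu nu.

End Defs.

(* Main.v *)
(* A continuous measure on [R] is an atomless measure on the circle [R u {oo}],
   and the Kuiper distance is the largest difference on arcs. Two measures are
   at the maximal distance 1 iff some arc separates them. Hence the measures
   carried by an arc [A] can be recovered from distances equal to 1, and a
   surjective isometry sends them to the measures carried by some arc [B]. As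
   [mu (~` A)] is the distance from [mu] to the measures carried by [A], in fact
   [phi mu B = mu A] for all [mu]. So [phi] acts on arcs, compatibly with
   differences of nested arcs; the images of the arcs [[oo, t]] therefore share
   an endpoint, which a Moebius map moves to [oo]. Then the distribution
   function of [phi mu] is that of [mu] reparametrized by an increasing
   bijection. *)
Require Import Defs.
From HB Require Import structures.
From mathcomp Require Import all_boot all_order all_algebra.
From mathcomp Require Import all_classical all_reals all_analysis.
From mathcomp Require Import measurable_realfun ring lra.
Set Implicit Arguments. Unset Strict Implicit. Unset Printing Implicit Defensive.
Import Order.TTheory GRing.Theory Num.Theory.
Import numFieldNormedType.Exports.
Local Open Scope classical_set_scope.
Local Open Scope ring_scope.

(** * Atomless probability measures *)

(** The circle itself never appears: everything lives on the line, and the price is paid in finite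
    exceptional sets. Since [0^-1 = 0], each [r_ x] is a total bijection of the line that sends its
    pole to 0, where the true Moebius map would give oo. It therefore respects arcs only up to
    finitely many points, and so do the endpoints of intervals. Atomless measures do not see finite
    sets, so every comparison of arcs carries a list of excepted points. An isometry yields image
    arcs only through their measures. The shape of such an arc is read off by testing it on measures
    carried by small intervals, and a configuration is refuted when the difference of two nested
    images would have two components on the circle. This needs a base point: the image of the ray
    ending at 0 is first turned into a ray by one of four explicit Moebius maps, which are composed
    back at the end. *)

Section RealValued.
Variable R : realType.
Implicit Types (mu nu : Pc R) (A B : set R).

Definition prb mu A : R := fine ((mu : probability R R) A).

Lemma prbE mu A : measurable A -> (mu : probability R R) A = (prb mu A)%:E.
Proof. by move=> mA; rewrite fineK// fin_num_measure. Qed.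

Lemma prb_ge0 mu A : 0 <= prb mu A.
Proof. exact/fine_ge0/measure_ge0. Qed.

Lemma prbT mu : prb mu setT = 1.
Proof. by rewrite /prb probability_setT. Qed.

Lemma prb0 mu : prb mu set0 = 0.
Proof. by rewrite /prb measure0. Qed.

Lemma prbU mu A B : measurable A -> measurable B -> A `&` B = set0 ->
  prb mu (A `|` B) = prb mu A + prb mu B.
Proof.
by move=> mA mB AB; rewrite /prb measureU// fineD// fin_num_measure.
Qed.

Lemma prbC mu A : measurable A -> prb mu (~` A) = 1 - prb mu A.
Proof.
move=> mA; apply/eqP; rewrite eq_sym subr_eq addrC -prbU ?setUv ?prbT ?setICr//.
exact: measurableC.
Qed.

Lemma prb_split mu A B : measurable A -> measurable B ->
  prb mu A = prb mu (A `&` B) + prb mu (A `&` ~` B).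
Proof.
move=> mA mB; have mC := measurableC mB.
rewrite -prbU ?setIUr -?setIUr ?setUv ?setIT//; do ?exact: measurableI.
by rewrite setIACA setICr setI0.
Qed.

Lemma prb_le mu A B : measurable A -> measurable B -> A `<=` B ->
  prb mu A <= prb mu B.
Proof.
by move=> mA mB AB; rewrite fine_le ?fin_num_measure ?le_measure ?inE.
Qed.

Lemma prb_le1 mu A : measurable A -> prb mu A <= 1.
Proof. by move=> mA; rewrite -(prbT mu) prb_le. Qed.

(** An atomless measure ignores the finite list [s], which is peeled off one point at a time. *)
Lemma prb_eq_off (s : seq R) mu A B : measurable A -> measurable B ->
  (forall t, t \notin s -> A t <-> B t) -> prb mu A = prb mu B.
Proof.
suff le A' B' : measurable A' -> measurable B' ->
    (forall t, t \notin s -> A' t -> B' t) -> prb mu A' <= prb mu B'.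
  move=> mA mB AB; apply/eqP.
  by rewrite eq_le !le// => t ts; apply AB.
elim: s A' => [|a s IH] A' mA mB AB.
  by apply: prb_le => // t; exact: AB.
have ma : measurable [set a] by exact: measurable_set1.
rewrite (prb_split mu mA ma).
have -> : prb mu (A' `&` [set a]) = 0.
  apply/eqP; rewrite eq_le prb_ge0 andbT.
  have -> : (0 = prb mu [set a])%R by rewrite /prb (pc_cont mu).
  by apply: prb_le => //; exact: measurableI.
rewrite add0r; apply: IH => //.
  by apply: measurableI => //; exact: measurableC.
move=> t ts [At ta]; apply: AB => //; rewrite inE negb_or ts andbT.
exact/eqP.
Qed.

Lemma Pc_of_measure (m : {measure set R -> \bar R}) :
  m setT = 1%E -> (forall t, m [set t] = 0%E) ->
  exists nu : Pc R, forall A, (nu : probability R R) A = m A.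
Proof.
move=> m1 m0.
pose p : probability R R := mnormalize m (\d_(0 : R) : probability R R).
have pm A : p A = m A.
  by rewrite /p /= /mnormalize m1 onee_eq0 /= invr1 mule1.
by exists (@MkPc R p (fun t => etrans (pm _) (m0 t))) => A; exact: pm.
Qed.

(* Measures carry unspecified values on non-measurable sets, so equality of
   all values, and not just of the Borel ones, is required. *)
Lemma Pc_ext mu nu :
  (forall A, (mu : probability R R) A = (nu : probability R R) A) -> mu = nu.
Proof.
case: mu nu => [p hp] [q hq] /= pq.
suff e : p = q by rewrite -{q}e in hq pq *; rewrite (Prop_irrelevance hp hq).
move: p q pq {hp hq} => [f cf] [g cg] /= fg.
have {}fg : f = g by apply/funext.
move: cg; rewrite -{g}fg => cg; f_equal.
case: cf cg => [a1 b1 c1 d1 e1 f1 g1] [a2 b2 c2 d2 e2 f2 g2].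
case: a1 a2 b1 b2 => [a1 a1'] [a2 a2'] [b1] [b2].
case: c1 c2 d1 d2 => [c1] [c2] [d1] [d2].
case: e1 e2 f1 f2 g1 g2 => [e1] [e2] [f1] [f2] [g1] [g2].
rewrite (Prop_irrelevance a1 a2) (Prop_irrelevance a1' a2').
rewrite (Prop_irrelevance b1 b2).
rewrite (Prop_irrelevance c1 c2) (Prop_irrelevance d1 d2).
by rewrite (Prop_irrelevance e1 e2) (Prop_irrelevance f1 f2) (Prop_irrelevance g1 g2).
Qed.

End RealValued.

(** * Push-forward, conditioning, sweeping, and a law of full support *)

Section Constructions.
Variable R : realType.
Implicit Types (mu nu lam : Pc R) (A B : set R).

(** Injectivity excludes atoms, a fibre having at most one point. The identity covers all sets [A],
    measurable or not, so that [Pc_ext] applies to push-forwards. *)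
Lemma Pc_push (T : R -> R) : measurable_fun setT T -> injective T ->
  exists F : Pc R -> Pc R, forall mu A,
    (F mu : probability R R) A = (mu : probability R R) (T @^-1` A).
Proof.
move=> mT iT; suff /choice[F FE] : forall mu : Pc R, exists nu : Pc R, forall A,
    (nu : probability R R) A = (mu : probability R R) (T @^-1` A) by exists F.
move=> mu.
pose X : {mfun R >-> R} := HB.pack T (isMeasurableFun.Build _ _ _ _ T mT).
pose m : probability R R := distribution mu X.
have [||nu nuE] := @Pc_of_measure R m.
- exact: probability_setT.
- move=> t; change ((mu : probability R R) (T @^-1` [set t]) = 0%E).
  have [[x xt]|nx] := pselect (exists x, T x = t).
    rewrite (_ : T @^-1` [set t] = [set x]) ?(pc_cont mu)//.
    by apply/seteqP; split => y /=; [rewrite -xt => /iT|move=> ->].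
  rewrite (_ : T @^-1` [set t] = set0) ?measure0//.
  by apply/seteqP; split => y //= yt; apply: nx; exists y.
by exists nu.
Qed.

Lemma Pc_cond lam A : measurable A -> 0 < prb lam A ->
  exists nu, forall B, measurable B -> prb nu B = prb lam (B `&` A) / prb lam A.
Proof.
move=> mA A0.
have A0' : 0 <= (prb lam A)^-1 by rewrite invr_ge0 prb_ge0.
pose m : {measure set R -> \bar R} := mscale (NngNum A0') (mrestr lam mA).
have mE B : measurable B -> m B = (prb lam (B `&` A) / prb lam A)%:E.
  move=> mB; have mBA : measurable (B `&` A) by exact: measurableI.
  change (((prb lam A)^-1%:E * (lam : probability R R) (B `&` A))%E = (prb lam (B `&` A) / prb lam A)%:E).
  by rewrite (prbE lam mBA) mulrC.
have [||nu nuE] := @Pc_of_measure R m.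
- by rewrite mE ?setTI ?divff ?gt_eqF.
- move=> t; rewrite mE// (_ : prb _ _ = 0) ?mul0r//.
  apply/eqP; rewrite eq_le prb_ge0 andbT -[leRHS](_ : prb lam [set t] = 0).
    by apply: prb_le => //; exact: measurableI.
  by rewrite /prb (pc_cont lam).
by exists nu => B mB; rewrite {1}/prb nuE mE.
Qed.

(** The mass that [mu] has outside [A] is redistributed over [A] following [lam]. *)
Lemma Pc_sweep mu lam A : measurable A -> prb lam A = 1 ->
  exists nu, forall B, measurable B ->
    prb nu B = prb mu (B `&` A) + prb mu (~` A) * prb lam B.
Proof.
move=> mA lA; have mC := measurableC mA.
pose m : {measure set R -> \bar R} :=
  measure_add (mrestr mu mA) (mscale (NngNum (prb_ge0 mu (~` A))) lam).
have mE B : measurable B -> m B = (prb mu (B `&` A) + prb mu (~` A) * prb lam B)%:E.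
  move=> mB; have mBA : measurable (B `&` A) by exact: measurableI.
  etransitivity; first exact: measure_addE.
  rewrite EFinD EFinM -(prbE mu mBA) -(prbE lam mB).
  by [].
have [||nu nuE] := @Pc_of_measure R m.
- by rewrite mE// setTI prbT mulr1 prbC// addrC subrK.
- move=> t; rewrite mE// [prb lam _]/prb (pc_cont lam) mulr0 addr0; congr (_%:E).
  apply/eqP; rewrite eq_le prb_ge0 andbT -[leRHS](_ : prb mu [set t] = 0).
    by apply: prb_le => //; exact: measurableI.
  by rewrite /prb (pc_cont mu).
by exists nu => B mB; rewrite {1}/prb nuE mE.
Qed.

(** The standard normal law: its continuous positive density has a positive minimum on each compact
    interval. *)
Lemma Pc_full_support : exists lam, forall s t, s < t -> 0 < prb lam `]s, t].
Proof.
pose P' : probability (measurableTypeR R) R := normal_prob (0 : R) (1 : R).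
(* The normal law lives on [measurableTypeR R]; pushing it forward by the identity moves it to the
   structure used by [Pc]. *)
have mid : measurable_fun setT (idfun : measurableTypeR R -> R).
  by move=> _ B mB; rewrite setTI preimage_id.
pose X : {mfun measurableTypeR R >-> R} := HB.pack (idfun : measurableTypeR R -> R)
  (isMeasurableFun.Build _ _ _ _ (idfun : measurableTypeR R -> R) mid).
pose P : probability R R := distribution P' X.
have P0 t : P [set t] = 0%E.
  have := @normal_prob_dominates R 0 1.
  move=> /null_content_dominatesP; apply => //.
  exact: lebesgue_measure_set1.
exists (@MkPc R P P0) => s t st.
have mst : measurable (`]s, t]%classic : set R) by exact: measurable_itv.
suff h : (0 < P' `]s, t]%classic)%E.
  by apply: fine_gt0; rewrite h /= ltey_eq (fin_num_measure P).
change (0 < \int[lebesgue_measure]_(x in `]s, t]%classic) (normal_pdf (0 : R) 1 x)%:E)%E.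
have cf : continuous (normal_pdf (0 : R) 1) by apply: continuous_normal_pdf; exact: oner_neq0.
have [c _ cmin] := EVT_min (ltW st) (continuous_subspaceT cf).
have c0 : 0 < normal_pdf 0 1 c.
  by rewrite normal_pdfE ?oner_neq0// mulr_gt0 ?expR_gt0// normal_peak_gt0// oner_neq0.
apply: (@lt_le_trans _ _ ((normal_pdf 0 1 c)%:E * (t - s)%:E)%E).
  by rewrite lte_fin mulr_gt0// subr_gt0.
have -> : ((t - s)%:E = lebesgue_measure (`]s, t] : set R))%E.
  by rewrite lebesgue_measure_itv /= lte_fin st.
rewrite -integral_cst//; apply: ge0_le_integral => //.
- by move=> x _; rewrite lee_fin ltW.
- by apply/measurable_EFinP; apply: measurable_funTS; exact: measurable_normal_pdf.
- by move=> x /= xst; rewrite lee_fin cmin//; apply: subset_itv_oc_cc.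
Qed.

(** Closed left rays are stable under intersection, exhaust the line and generate the Borel sets. *)
Lemma distrf_unique (mu nu : probability R R) :
  (forall t, mu `]-oo, t]%classic = nu `]-oo, t]%classic) ->
  forall A, measurable A -> mu A = nu A.
Proof.
move=> h A mA.
pose G : set (set R) := [set B | exists t, B = `]-oo, t]%classic].
have mG : G `<=` measurable by move=> _ [t ->].
apply: (@g_sigma_algebra_measure_unique _ R _ G mG (fun n => `]-oo, n%:R]%classic)).
- by move=> n; exists n%:R.
- rewrite -subTset => t _ /=.
  by exists (Num.truncn t).+1; rewrite //= in_itv/= ltW// truncnS_gt.
- move=> _ _ [s ->] [t ->]; exists (Num.min s t).
  by apply/seteqP; split => x; rewrite /= !in_itv /= le_min => /andP.
- by move=> _ [t ->]; exact: h.
- by move=> k; rewrite (le_lt_trans (probability_le1 _ _)) ?ltry.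
- have : (@ocitv R).-sigma.-measurable A by exact: mA.
  rewrite RGenOInfty.measurableE; move: A {mA}.
  apply: smallest_sub; first exact: smallest_sigma_algebra.
  move=> _ [t ->]; rewrite -setCitvl; have [_ sC _] := smallest_sigma_algebra setT G.
  rewrite -setTD; apply: sC.
  by apply: sub_sigma_algebra; exists t.
Qed.

End Constructions.

(** * Arcs and the Kuiper distance *)

Section Arcs.
Variable R : realType.
Implicit Types (mu nu lam : Pc R) (A B : set R).

(* Arcs of the circle [R u {oo}], up to their endpoints and the point [oo]. *)
Definition arc A := is_interval A \/ is_interval (~` A).

Lemma arcC A : arc A -> arc (~` A).
Proof. by case=> hA; [right; rewrite setCK|left]. Qed.

Lemma arc_measurable A : arc A -> measurable A.
Proof.
case=> /is_interval_measurable // /measurableC.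
by rewrite setCK.
Qed.

Lemma arc_itv (i : interval R) : arc [set` i].
Proof. by left; exact: interval_is_interval. Qed.

(** Extended endpoints treat bounded intervals, rays and the whole line at once. *)
Definition oc (a b : \bar R) : set R := [set t | (a < t%:E <= b)%E].

Lemma oc_fin (a b : R) : oc a%:E b%:E = `]a, b]%classic.
Proof. by apply/seteqP; split => t; rewrite /oc /= lte_fin lee_fin in_itv. Qed.

Lemma oc_interval a b : is_interval (oc a b).
Proof.
move=> x y /andP[ax _] /andP[_ yb] z /andP[xz zy]; apply/andP; split.
  by apply: (lt_le_trans ax); rewrite lee_fin.
by apply: le_trans yb; rewrite lee_fin.
Qed.

Lemma oc_measurable a b : measurable (oc a b).
Proof. by apply: is_interval_measurable; exact: oc_interval. Qed.

Lemma interval_oc A : is_interval A ->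
  exists a b, (a <= b)%E /\
    exists s : seq R, forall t, t \notin s -> A t <-> oc a b t.
Proof.
move=> iA; have [A0|/set0P[x0 Ax0]] := eqVneq A set0.
  exists 0%E, 0%E; split=> //; exists [::] => t _; rewrite A0 /oc /=.
  by split=> // /andP[/lt_le_trans h /h]; rewrite ltxx.
pose a := ereal_inf (EFin @` A); pose b := ereal_sup (EFin @` A).
have lea t : A t -> (a <= t%:E)%E by move=> At; apply: ereal_inf_lbound; exists t.
have leb t : A t -> (t%:E <= b)%E by move=> At; apply: ereal_sup_ubound; exists t.
exists a, b; split; first exact: le_trans (lea _ Ax0) (leb _ Ax0).
(* Only the endpoints can be misplaced; at an infinite end [fine] gives 0, a harmless extra
   exception. *)
exists [:: fine a; fine b] => t; rewrite !inE negb_or => /andP[ta tb]; split.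
  move=> At; apply/andP; split; last exact: leb.
  rewrite lt_neqAle lea// andbT; apply: contra ta => /eqP ->.
  exact: eqxx.
move=> /andP[at_ tb']; have {}tb' : (t%:E < b)%E.
  by rewrite lt_neqAle tb' andbT; apply: contra tb => /eqP <-; exact: eqxx.
have [_ [x Ax <-] xt] := ereal_inf_lt at_.
have [_ [y Ay <-] ty] := ereal_sup_gt tb'.
by apply: (iA x y) => //; rewrite -!lee_fin !ltW.
Qed.

(** The distribution function on the compactified line, where the suprema of [d_Ku] are attained. *)
Definition ecdf mu (e : \bar R) := prb mu [set t | (t%:E <= e)%E].

Lemma oc_Ny e : oc -oo%E e = [set t | (t%:E <= e)%E].
Proof. by apply/seteqP; split => t; rewrite /oc /= ltNyr. Qed.

Lemma prb_oc mu a b : (a <= b)%E -> prb mu (oc a b) = ecdf mu b - ecdf mu a.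
Proof.
move=> ab; rewrite /ecdf -!oc_Ny.
have mo := oc_measurable.
have e1 : oc -oo%E b `&` oc -oo%E a = oc -oo%E a.
  apply/seteqP; split => t; rewrite /oc /= ltNyr//=; first by case.
  by move=> ta; split=> //; exact: le_trans ab.
have e2 : oc -oo%E b `&` ~` oc -oo%E a = oc a b.
  apply/seteqP; split => t; rewrite /oc /= ltNyr/=.
    by case=> tb /negP; rewrite -ltNge => at_; apply/andP.
  by move=> /andP[at_ tb]; split=> //; apply/negP; rewrite -ltNge.
by rewrite (prb_split mu (mo -oo%E b) (mo -oo%E a)) e1 e2 addrAC subrr add0r.
Qed.

Lemma ecdf_fin mu t : ecdf mu t%:E = distrf mu t.
Proof.
by congr (fine (_ _)); apply/seteqP; split => x; rewrite /= lee_fin in_itv.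
Qed.

Lemma ecdf_y mu : ecdf mu +oo%E = 1.
Proof.
rewrite /ecdf (_ : [set _ | _] = setT) ?prbT//.
by apply/seteqP; split => x //= _; rewrite leey.
Qed.

Lemma ecdf_Ny mu : ecdf mu -oo%E = 0.
Proof.
rewrite /ecdf (_ : [set _ | _] = set0) ?prb0//.
by apply/seteqP; split => x.
Qed.

Lemma prb_cvg0 mu (A : (set R)^nat) (e : R) : (forall n, measurable (A n)) ->
  (forall n m, (n <= m)%N -> A m `<=` A n) ->
  prb mu (\bigcap_n A n) = 0 -> 0 < e -> exists n, prb mu (A n) < e.
Proof.
move=> mA dA A0 e0.
have mI : measurable (\bigcap_n A n) by exact: bigcapT_measurable.
have h : (mu : probability R R) \o A @ \oo --> (mu : probability R R) (\bigcap_n A n).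
  apply: nonincreasing_cvg_mu => //.
    by rewrite (le_lt_trans (probability_le1 _ _)) ?ltry.
  by move=> n m nm; apply/subsetPset; exact: dA.
move: h; rewrite (prbE mu mI) A0 => /fine_cvg h.
have /cvgr_lt/(_ e e0)[N _ hN] := h.
by exists N; exact: (hN N (leqnn N)).
Qed.

Lemma distrf_le mu s t : s <= t -> distrf mu s <= distrf mu t.
Proof.
by move=> st; apply: prb_le => // x /=; rewrite !in_itv /= => /le_trans; exact.
Qed.

Lemma distrf_itv mu s t : s <= t ->
  prb mu `]s, t]%classic = distrf mu t - distrf mu s.
Proof. by move=> st; rewrite -oc_fin prb_oc ?lee_fin// !ecdf_fin. Qed.

Lemma distrf_small mu e : 0 < e -> exists t, distrf mu t < e.
Proof.
move=> e0; have [|||//|n hn] := @prb_cvg0 mu (fun n => `]-oo, - n%:R]%classic) e.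
- by move=> n.
- move=> n m nm x /=; rewrite !in_itv /= => /le_trans; apply.
  by rewrite lerN2 ler_nat.
- rewrite (_ : \bigcap_n _ = set0) ?prb0// -subset0 => x /(_ (Num.truncn (- x)).+1 I).
  by rewrite /= in_itv /= lerNr leNgt truncnS_gt.
by exists (- n%:R).
Qed.

Lemma distrf_big mu e : 0 < e -> exists t, 1 - e < distrf mu t.
Proof.
move=> e0; have [|||//|n hn] := @prb_cvg0 mu (fun n => ~` `]-oo, n%:R]%classic) e.
- by move=> n; exact: measurableC.
- move=> n m nm x /= h h'; apply: h; move: h'; rewrite !in_itv /= => /le_trans; apply.
  by rewrite ler_nat.
- rewrite (_ : \bigcap_n _ = set0) ?prb0// -subset0 => x /(_ (Num.truncn x).+1 I).
  by rewrite /= in_itv /=; apply; rewrite ltW// truncnS_gt.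
by exists n%:R; move: hn; rewrite prbC// ltrBlDr addrC -ltrBlDr.
Qed.

(** Intervals shrinking to [t] have intersection the null set of the single point [t], so their
    measures tend to 0. *)
Lemma distrf_continuous mu : continuous (distrf mu).
Proof.
move=> t; apply/cvgrPdist_lt => e e0.
have [|||//|n hn] := @prb_cvg0 mu (fun n => `](t - n.+1%:R^-1), (t + n.+1%:R^-1)]%classic) e.
- by move=> n.
- move=> n m nm x /=; rewrite !in_itv /= => /andP[h1 h2].
  have nm' : m.+1%:R^-1 <= n.+1%:R^-1 :> R by rewrite lef_pV2 ?posrE// ler_nat.
  by move: m.+1%:R^-1 n.+1%:R^-1 nm' h1 h2 => p q *; apply/andP; split; lra.
- rewrite (@prb_eq_off R [:: t] _ _ set0) ?prb0//.
    by apply: bigcapT_measurable.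
  move=> x; rewrite inE => xt; split=> // h; exfalso.
  have d0 : 0 < `|x - t| by rewrite normr_gt0 subr_eq0.
  have := h (Num.truncn `|x - t|^-1) I; rewrite /= in_itv /= => /andP[h1 h2].
  have : (Num.truncn `|x - t|^-1).+1%:R^-1 < `|x - t|.
    by rewrite invf_plt ?posrE// truncnS_gt.
  rewrite ltNge => /negP; apply; rewrite ler_norml.
  move: (_.+1%:R^-1) h1 h2 => p *; apply/andP; split; lra.
have : 0 < n.+1%:R^-1 :> R by rewrite invr_gt0.
move: (n.+1%:R^-1) hn => d hn d0.
rewrite distrf_itv in hn; last by lra.
near=> x.
have : `|t - x| < d.
  by near: x; apply: cvgr_dist_lt => //; exact: cvg_id.
rewrite ltr_norml => /andP[x1 x2].
have a1 : distrf mu (t - d) <= distrf mu x by apply: distrf_le; lra.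
have a2 : distrf mu x <= distrf mu (t + d) by apply: distrf_le; lra.
have a3 : distrf mu (t - d) <= distrf mu t by apply: distrf_le; lra.
have a4 : distrf mu t <= distrf mu (t + d) by apply: distrf_le; lra.
rewrite ltr_norml; apply/andP; split; lra.
Unshelve. all: by end_near.
Qed.

Lemma distrf_ge0 mu t : 0 <= distrf mu t.
Proof. exact: prb_ge0. Qed.

Lemma distrf_le1 mu t : distrf mu t <= 1.
Proof. exact: prb_le1. Qed.

Lemma distrf_sub_has_sup mu nu :
  has_sup [set distrf mu t - distrf nu t | t in [set: R]].
Proof.
split; first by exists (distrf mu 0 - distrf nu 0), 0.
exists 1 => _ [t _ <-].
have := distrf_ge0 nu t; have := distrf_le1 mu t; lra.
Qed.

Lemma distrf_sub_le_sup mu nu t :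
  distrf mu t - distrf nu t <= sup [set distrf mu t - distrf nu t | t in [set: R]].
Proof. by apply: sup_upper_bound; [exact: distrf_sub_has_sup|exists t]. Qed.

Lemma ecdf_sub_le_sup mu nu e :
  ecdf mu e - ecdf nu e <= sup [set distrf mu t - distrf nu t | t in [set: R]].
Proof.
(* Far to the left the second term is negligible; this bound settles the two infinite values of
   [e]. *)
have s0 : 0 <= sup [set distrf mu t - distrf nu t | t in [set: R]].
  apply/ler_addgt0Pl => d d0; have [t td] := distrf_small nu d0.
  have := distrf_sub_le_sup mu nu t; have := distrf_ge0 mu t; lra.
case: e => [t| |]; first by rewrite !ecdf_fin distrf_sub_le_sup.
  by rewrite !ecdf_y subrr.
by rewrite !ecdf_Ny subrr.
Qed.

(** If the difference is nowhere positive, its supremum is the value 0 at -oo. Otherwise it falls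
    below a positive value [e] outside a compact interval, on which a continuous function has a
    maximum. *)
Lemma sup_attained mu nu : exists e : \bar R,
  sup [set distrf mu t - distrf nu t | t in [set: R]] = ecdf mu e - ecdf nu e.
Proof.
have [h|] := pselect (forall t, distrf mu t - distrf nu t <= 0).
  exists -oo%E; apply/eqP; rewrite eq_le ecdf_sub_le_sup andbT.
  rewrite !ecdf_Ny subrr; apply: ge_sup; first by case: (distrf_sub_has_sup mu nu).
  by move=> _ [t _ <-].
move=> /existsNP[t0 /negP]; rewrite -ltNge.
set e := _ - _ => e0.
have [a ha] := distrf_small mu e0; have [b hb] := distrf_big nu e0.
have out t : e <= distrf mu t - distrf nu t -> a <= t <= b.
  move=> et; apply/andP; split; rewrite leNgt; apply/negP => tt.
    have := distrf_le mu (ltW tt); have := distrf_ge0 nu t; lra.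
  have := distrf_le nu (ltW tt); have := distrf_le1 mu t; lra.
have /andP[at0 t0b] := out t0 (lexx _).
have cf : continuous (fun t => distrf mu t - distrf nu t).
  by move=> x; apply: (@cvgB _ R^o); exact: distrf_continuous.
have [c _ cmax] := EVT_max (le_trans at0 t0b) (continuous_subspaceT cf).
exists c%:E; apply/eqP; rewrite eq_le ecdf_sub_le_sup andbT !ecdf_fin.
apply: ge_sup; first by case: (distrf_sub_has_sup mu nu).
move=> _ [t _ <-].
have ec : e <= distrf mu c - distrf nu c by apply: cmax; rewrite in_itv /= at0.
have [et|/ltW te] := leP e (distrf mu t - distrf nu t).
  by apply: cmax; rewrite in_itv /= out.
exact: le_trans te ec.
Qed.

(** Complements have the same absolute difference, so [A] may be an interval. The difference on it
    splits into one term at each endpoint, and each is bounded by one of the two suprema. *)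
Lemma d_Ku_ge mu nu A : arc A -> `|prb mu A - prb nu A| <= d_Ku mu nu.
Proof.
move=> hA; wlog iA : A hA / is_interval A.
  move=> wl; case: (hA) => [|iA]; first exact: wl.
  have mA := arc_measurable hA.
  by rewrite -normrN -[X in X <= _](_ : `|prb mu (~` A) - prb nu (~` A)| = _);
    [apply: wl => //; exact: arcC|rewrite !prbC//; congr `|_|; ring].
have [a [b [ab [s hs]]]] := interval_oc iA.
rewrite !(prb_eq_off _ (arc_measurable hA) (oc_measurable a b) hs) !prb_oc//.
have h1 := ecdf_sub_le_sup mu nu a; have h2 := ecdf_sub_le_sup mu nu b.
have h3 := ecdf_sub_le_sup nu mu a; have h4 := ecdf_sub_le_sup nu mu b.
by rewrite /d_Ku ler_norml; apply/andP; split; lra.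
Qed.

(** The suprema run over independent points [s] and [t]; the sum of their terms is, up to sign, the
    difference on the interval between them, or 0 when [s = t]. *)
Lemma d_Ku_le mu nu c : 0 <= c ->
  (forall s t, s < t -> `|prb mu `]s, t]%classic - prb nu `]s, t]%classic| <= c) ->
  d_Ku mu nu <= c.
Proof.
move=> c0 h; rewrite /d_Ku -lerBrDr; apply: ge_sup.
  by case: (distrf_sub_has_sup mu nu).
move=> _ [s _ <-]; rewrite lerBrDl -lerBrDr; apply: ge_sup.
  by case: (distrf_sub_has_sup nu mu).
move=> _ [t _ <-].
have [st|ts|->] := ltgtP s t; last lra.
  by have := h _ _ st; rewrite !(distrf_itv _ (ltW st)) ler_norml => /andP[]; lra.
by have := h _ _ ts; rewrite !(distrf_itv _ (ltW ts)) ler_norml => /andP[]; lra.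
Qed.

Lemma d_Ku_eq1 mu nu :
  d_Ku mu nu = 1 <-> exists A, [/\ arc A, prb mu A = 1 & prb nu A = 0].
Proof.
split; last first.
  move=> [A [hA A1 A0]]; apply/eqP; rewrite eq_le; apply/andP; split.
    apply: d_Ku_le => // s t st.
    have m1 : measurable (`]s, t]%classic : set R) by [].
    have := prb_ge0 mu `]s, t]%classic; have := prb_ge0 nu `]s, t]%classic.
    have := prb_le1 mu m1; have := prb_le1 nu m1.
    by rewrite ler_norml => *; apply/andP; split; lra.
  by have := d_Ku_ge mu nu hA; rewrite A1 A0 subr0 normr1.
have [e1 E1] := sup_attained mu nu; have [e2 E2] := sup_attained nu mu.
rewrite /d_Ku E1 E2 => d1.
have bnd a b : prb mu (oc a b) - prb nu (oc a b) = 1 ->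
    prb mu (oc a b) = 1 /\ prb nu (oc a b) = 0.
  have := prb_le1 mu (oc_measurable a b); have := prb_ge0 nu (oc a b).
  by split; lra.
have bnd' a b : prb nu (oc a b) - prb mu (oc a b) = 1 ->
    prb nu (oc a b) = 1 /\ prb mu (oc a b) = 0.
  have := prb_le1 nu (oc_measurable a b); have := prb_ge0 mu (oc a b).
  by split; lra.
(* The points [e1] and [e2] where the suprema are attained cut the circle into two arcs, one
   carrying [mu] and the other [nu]; their order tells which is which. *)
have [le12|/ltW le21] := leP e1 e2.
  have [|p q] := bnd' e1 e2; first by rewrite !prb_oc//; lra.
  exists (~` oc e1 e2); split; first by apply: arcC; left; exact: oc_interval.
    by rewrite prbC ?q ?subr0//; exact: oc_measurable.
  by rewrite prbC ?p ?subrr//; exact: oc_measurable.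
have [|p q] := bnd e2 e1; first by rewrite !prb_oc//; lra.
by exists (oc e2 e1); split=> //; left; exact: oc_interval.
Qed.

End Arcs.

(** * Surjective isometries act on arcs *)

Section ArcImages.
Variable R : realType.
Implicit Types (mu nu lam : Pc R) (A B : set R).

Lemma prb_eq0_sub mu A B : measurable A -> measurable B -> A `<=` B ->
  prb mu B = 0 -> prb mu A = 0.
Proof.
by move=> mA mB AB B0; apply/eqP; rewrite eq_le prb_ge0 andbT -B0 prb_le.
Qed.

Lemma prb_eq0_setI mu A B : measurable A -> measurable B ->
  prb mu (A `&` B) = 0 -> prb mu (A `&` ~` B) = 0 -> prb mu A = 0.
Proof. by move=> mA mB h1 h2; rewrite (prb_split mu mA mB) h1 h2 addr0. Qed.

Definition full_support lam := forall s t, s < t -> 0 < prb lam `]s, t]%classic.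

(** An interval with two points has positive [lam]-measure, so a null one has at most one point. *)
Lemma full_support_interval lam A nu : full_support lam -> is_interval A ->
  prb lam A = 0 -> prb nu A = 0.
Proof.
move=> fl iA A0; have mA := is_interval_measurable iA.
have [[s [t [As At st]]]|h] := pselect (exists s t, [/\ A s, A t & s < t]).
  have : prb lam `]s, t]%classic <= prb lam A.
    apply: prb_le => // x; rewrite /= in_itv /= => /andP[sx xt].
    by apply: (iA s t) => //; rewrite (ltW sx).
  by rewrite A0 leNgt fl.
have [A0'|/set0P[x Ax]] := eqVneq A set0; first by rewrite A0' prb0.
rewrite (@prb_eq_off _ [:: x] nu A set0) ?prb0// => t; rewrite inE => tx.
split=> // At; move: tx; rewrite neq_lt => /orP[tx|xt].
  by apply: h; exists t, x.
by apply: h; exists x, t.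
Qed.

(** When the complement is an interval, the pieces are the points below all of it and the points of
    [A] above some of it. *)
Lemma arc_split A : arc A -> exists I J, [/\ is_interval I, is_interval J &
  forall t, A t <-> I t \/ J t].
Proof.
case=> iA; first by exists A, set0; split=> // t; split; [left|case].
exists [set t | forall k, ~ A k -> t < k],
  [set t | A t /\ exists2 k, ~ A k & k < t]; split.
- move=> x y _ hy z /andP[_ zy] k /hy.
  exact: le_lt_trans.
- move=> x y [Ax [k nAk kx]] [Ay _] z /andP[xz zy]; split; last first.
    by exists k => //; exact: lt_le_trans xz.
  apply: contrapT => nAz; apply: (iA k z) Ax => //.
  by rewrite (ltW kx).
move=> t; split; last first.
  case=> [h|[]//]; apply: contrapT => nAt.
  by have := h _ nAt; rewrite ltxx.
move=> At; have [h|h] := pselect (exists2 k, ~ A k & k < t).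
  by right.
left=> k nAk; rewrite ltNge; apply/negP; rewrite le_eqVlt => /orP[/eqP e|kt].
  by apply: nAk; rewrite e.
by apply: h; exists k.
Qed.

(** By [arc_split] the intersection is a union of four intervals, and [full_support_interval]
    applies to each. *)
Lemma full_support_arcs lam A B nu : full_support lam -> arc A -> arc B ->
  prb lam (A `&` B) = 0 -> prb nu (A `&` B) = 0.
Proof.
move=> fl aA aB; have mA := arc_measurable aA; have mB := arc_measurable aB.
have [I1 [J1 [iI1 iJ1 h1]]] := arc_split aA.
have [I2 [J2 [iI2 iJ2 h2]]] := arc_split aB.
have meas (K : set R) : is_interval K -> measurable K by exact: is_interval_measurable.
have mAB : measurable (A `&` B) by exact: measurableI.
have piece (K1 K2 : set R) : is_interval K1 -> is_interval K2 -> K1 `<=` A -> K2 `<=` B ->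
    prb lam (A `&` B) = 0 -> prb nu (K1 `&` K2) = 0.
  move=> i1 i2 s1 s2 h; have mK : measurable (K1 `&` K2) by apply: measurableI; exact: meas.
  apply: (@full_support_interval lam (K1 `&` K2) nu fl); last first.
    by apply: (prb_eq0_sub mK mAB _ h); exact: setISS.
  by move=> x y [x1 x2] [y1 y2] z xzy; split; [exact: (i1 x y)|exact: (i2 x y)].
have sI1 : I1 `<=` A by move=> t ?; apply/h1; left.
have sJ1 : J1 `<=` A by move=> t ?; apply/h1; right.
have sI2 : I2 `<=` B by move=> t ?; apply/h2; left.
have sJ2 : J2 `<=` B by move=> t ?; apply/h2; right.
have strip (K : set R) : is_interval K -> K `<=` A -> prb lam (A `&` B) = 0 ->
    prb nu (K `&` B) = 0.
  move=> iK sK h; have mK := meas _ iK.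
  have mKB : measurable (K `&` B) by exact: measurableI.
  apply: (prb_eq0_setI mKB (meas _ iI2)).
    apply: (prb_eq0_sub _ (measurableI _ _ mK (meas _ iI2))) (piece _ _ iK iI2 sK sI2 h).
      by apply: measurableI => //; exact: meas.
    by move=> t [[]].
  apply: (prb_eq0_sub _ (measurableI _ _ mK (meas _ iJ2))) (piece _ _ iK iJ2 sK sJ2 h).
    by apply: measurableI => //; apply: measurableC; exact: meas.
  by move=> t [[Kt /h2[]]].
move=> h; apply: (prb_eq0_setI mAB (meas _ iI1)).
  apply: (prb_eq0_sub _ (measurableI _ _ (meas _ iI1) mB)) (strip _ iI1 sI1 h).
    by apply: measurableI => //; exact: meas.
  by move=> t [[]].
apply: (prb_eq0_sub _ (measurableI _ _ (meas _ iJ1) mB)) (strip _ iJ1 sJ1 h).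
  by apply: measurableI => //; apply: measurableC; exact: meas.
by move=> t [[/h1[]]].
Qed.

(* [lam] has support exactly [A], so a measure at distance 1 from it
   lives on the complementary arc. *)
Lemma arc_filling A mu : arc A -> 0 < prb mu A ->
  exists lam, prb lam A = 1 /\ forall nu, d_Ku lam nu = 1 -> prb nu A = 0.
Proof.
move=> aA muA; have mA := arc_measurable aA.
have [l0 fl] := Pc_full_support R.
have lA : 0 < prb l0 A.
  rewrite lt0r prb_ge0 andbT; apply: contraTN muA => /eqP l0A.
  suff -> : prb mu A = 0 by rewrite ltxx.
  rewrite -(setIid A); apply: (@full_support_arcs l0 A A mu fl) => //.
  by rewrite setIid.
have [lam lamE] := Pc_cond mA lA; exists lam.
split=> [|nu /d_Ku_eq1[B [aB B1 B0]]].
  by rewrite lamE// setIid divff// gt_eqF.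
have mB := arc_measurable aB; have mC := measurableC mB.
(* Inside [B] the measure [nu] vanishes; the part of [A] outside [B] is null for [lam], hence for
   [l0], hence for every atomless measure. *)
apply: (prb_eq0_setI mA mB).
  by apply: (prb_eq0_sub (measurableI _ _ mA mB) mB _ B0) => t [].
apply: (@full_support_arcs l0 A (~` B) nu fl) => //; first exact: arcC.
have : prb lam (~` B) = 0 by rewrite prbC// B1 subrr.
by rewrite lamE// setIC => /eqP; rewrite mulf_eq0 invr_eq0 [X in _ || X]gt_eqF// orbF => /eqP.
Qed.

(** For the swept measure, the difference on an interval is between the mass taken away and the mass
    put back, both at most [mu] of the complement of [A]. *)
Lemma sweep_dist A mu lam : measurable A -> prb lam A = 1 ->
  exists nu, prb nu A = 1 /\ d_Ku mu nu <= prb mu (~` A).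
Proof.
move=> mA lA; have mC := measurableC mA.
have [nu nuE] := Pc_sweep mu mA lA; exists nu; split.
  by rewrite nuE// setIid lA mulr1 prbC// addrC subrK.
apply: d_Ku_le; first exact: prb_ge0.
move=> s t st.
have : measurable (`]s, t]%classic : set R) by [].
move: `]s, t]%classic => B mB.
rewrite nuE// (prb_split mu mB mA).
have h1 : prb mu (B `&` ~` A) <= prb mu (~` A).
  by apply: prb_le => //; exact: measurableI.
have h2 : prb mu (~` A) * prb lam B <= prb mu (~` A).
  by rewrite ler_piMr ?prb_ge0// prb_le1.
have h3 : 0 <= prb mu (~` A) * prb lam B by rewrite mulr_ge0 ?prb_ge0.
have h4 := prb_ge0 mu (B `&` ~` A).
by rewrite ler_norml; apply/andP; split; lra.
Qed.

(** The condition on [mu] excludes the arcs that are null, or of full measure, for all atomless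
    measures. *)
Definition arc_map (phi : Pc R -> Pc R) := forall A, arc A ->
  (exists mu, 0 < prb mu A < 1) ->
  exists B, arc B /\ forall mu, prb (phi mu) B = prb mu A.

(* If [lam] fills [A] and [mu] fills the complement, a separating arc [B] of
   their images satisfies: [nu] lives on [A] iff [phi nu] lives on [B]. Since
   [prb mu (~` A)] is the distance from [mu] to the measures living on [A],
   the value of [mu] on [A] is carried over to [phi mu] and [B]. *)
Lemma isometry_arc_map (phi : Pc R -> Pc R) :
  surjective_Pc phi -> Ku_isometry phi -> arc_map phi.
Proof.
move=> sphi iphi A aA [mu0 /andP[muA muA1]].
have mA := arc_measurable aA; have aC := arcC aA; have mC := measurableC mA.
have [lam [lam1 lamP]] := arc_filling aA muA.
have [mu [mu1 muP]] : exists l, prb l (~` A) = 1 /\ forall nu, d_Ku l nu = 1 -> prb nu (~` A) = 0.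
  by apply: (@arc_filling _ mu0); rewrite // prbC// subr_gt0.
have disj A' (a' : arc A') l n : prb l A' = 1 -> prb n (~` A') = 1 -> d_Ku l n = 1.
  move=> h1 h2; apply/d_Ku_eq1; exists A'; split=> //.
  by move: h2; rewrite prbC; [lra|exact: arc_measurable].
have /d_Ku_eq1[B [aB B1 B0]] : d_Ku (phi lam) (phi mu) = 1.
  by rewrite iphi; apply: disj lam1 mu1.
have mB := arc_measurable aB; have mCB := measurableC mB.
have CB1 : prb (phi mu) (~` B) = 1 by rewrite prbC// B0 subr0.
have [rho [rho1 rhoP]] : exists l, prb l (~` B) = 1 /\ forall nu, d_Ku l nu = 1 -> prb nu (~` B) = 0.
  by apply: (@arc_filling _ (phi mu)); [exact: arcC|rewrite CB1].
have back nu : prb (phi nu) B = 1 -> prb nu A = 1.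
  move=> h; have : d_Ku mu nu = 1.
    by rewrite -iphi; apply: (disj (~` B)) => //; [exact: arcC|rewrite setCK].
  by move/muP; rewrite prbC//; lra.
have back' nu : prb (phi nu) (~` B) = 1 -> prb nu (~` A) = 1.
  move=> h; have : d_Ku lam nu = 1 by rewrite -iphi; apply: (disj B).
  by move/lamP; rewrite prbC// => ->; rewrite subr0.
(* A preimage [r] of [rho] lives off [A] by [back'], so it is at distance 1 from [nu]; applying
   [phi] puts [phi nu] at distance 1 from [rho], which fills the complement of [B]. *)
have forth nu : prb nu A = 1 -> prb (phi nu) B = 1.
  move=> h; have [r rE] := sphi rho.
  have /rhoP : d_Ku rho (phi nu) = 1.
    rewrite -rE iphi; apply: (disj (~` A)) => //; last by rewrite setCK.
    by apply: back'; rewrite rE.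
  by rewrite prbC//; lra.
exists B; split=> // nu.
suff : prb (phi nu) (~` B) = prb nu (~` A) by rewrite !prbC//; lra.
(* Sweep [nu] onto [A] and map forward for one inequality; sweep [phi nu] onto [B] and pull back by
   surjectivity for the other. *)
apply/eqP; rewrite eq_le; apply/andP; split.
  have [n [n1 nd]] := sweep_dist nu mA lam1.
  have := d_Ku_ge (phi nu) (phi n) (arcC aB); rewrite iphi.
  by rewrite (prbC (phi n) mB) forth// subrr subr0 ger0_norm ?prb_ge0//; lra.
have [n [n1 nd]] := sweep_dist (phi nu) mB B1; have [m mE] := sphi n.
have := d_Ku_ge nu m aC; rewrite -iphi mE.
by rewrite (prbC m mA) back ?mE// subrr subr0 ger0_norm ?prb_ge0//; lra.
Qed.

End ArcImages.

(** * Bijections preserving arcs *)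

Section ArcPreserving.
Variable R : realType.
Implicit Types (mu nu : Pc R) (A B : set R) (T S : R -> R).

(** Finitely many exceptions are allowed because of the value of an inversion at its pole. *)
Definition arc_preserving T := forall A, arc A ->
  exists2 A', arc A' & exists s : seq R, forall t, t \notin s -> A' t <-> A (T t).

Definition arc_bijection T T' :=
  [/\ cancel T T', cancel T' T, arc_preserving T & arc_preserving T'].

Lemma arc_preserving_measurable T : arc_preserving T -> measurable_fun setT T.
Proof.
move=> pT; have meas A : arc A -> measurable (T @^-1` A).
  move=> aA; have [A' aA' [s hs]] := pT A aA.
  have mfin (B : set R) : finite_set B -> measurable B.
    move=> fB; apply: (@countable_measurable _ R B) => //.
    exact: finite_set_countable.
  rewrite (_ : T @^-1` A = (A' `\` [set` s]) `|` (T @^-1` A `&` [set` s])).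
    apply: measurableU.
      apply: measurableD; first exact: arc_measurable.
      by apply: mfin; exact: finite_seq.
    apply: mfin; apply: (@sub_finite_set _ _ [set` s]); last exact: finite_seq.
    exact: subIsetr.
  apply/seteqP; split => t /=.
    move=> At; have [ts|ts] := boolP (t \in s); first by right.
    by left; split; [apply/hs|exact/negP].
  by move=> [[A't /negP ts]|[]//]; apply/hs.
apply: (measurability (@RGenOInfty.G R)).
  exact: RGenOInfty.measurableE.
move=> _ [_ [x ->] <-]; rewrite setTI; apply: meas; exact: arc_itv.
Qed.

Lemma arc_preserving_comp T S S' : cancel S S' ->
  arc_preserving T -> arc_preserving S -> arc_preserving (T \o S).
Proof.
move=> SK pT pS A /pT[A1 a1 [s1 h1]]; have [A2 a2 [s2 h2]] := pS _ a1.
exists A2 => //; exists (map S' s1 ++ s2) => t.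
rewrite mem_cat negb_or => /andP[t1 t2]; rewrite h2// h1//.
by apply: contra t1 => t1; apply/mapP; exists (S t).
Qed.

Lemma arc_bijection_comp T T' S S' :
  arc_bijection T T' -> arc_bijection S S' -> arc_bijection (T \o S) (S' \o T').
Proof.
move=> [k1 k2 p1 p2] [k3 k4 p3 p4]; split.
- exact: can_comp.
- exact: can_comp.
- exact: arc_preserving_comp p1 p3.
- exact: arc_preserving_comp p4 p2.
Qed.

Lemma interval_preimage_preserving T :
  (forall A, is_interval A -> is_interval (T @^-1` A)) -> arc_preserving T.
Proof.
move=> h A aA; exists (T @^-1` A); last by exists [::].
by case: aA => iA; [left|right; rewrite preimage_setC]; exact: h.
Qed.

Lemma homeomorphism_arc_bijection (g h : R -> R) :
  cancel g h -> cancel h g -> continuous g -> continuous h -> arc_bijection g h.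
Proof.
suff pres (u v : R -> R) : cancel u v -> cancel v u -> continuous v -> arc_preserving u.
  by move=> gK hK cg ch; split=> //; [exact: (pres g h)|exact: (pres h g)].
move=> uK vK cv; apply: interval_preimage_preserving => A iA.
rewrite (_ : u @^-1` A = v @` A); last first.
  apply/seteqP; split => t /=; first by exists (u t).
  by move=> [x Ax <-]; rewrite vK.
apply/connected_intervalP; apply: connected_continuous_connected.
  exact/connected_intervalP.
exact: continuous_subspaceT.
Qed.

(** An interval missing 0 lies on one side of it, where inversion is monotone. For an interval
    containing 0, the inverse image is the complement of an interval, up to the point 0. *)
Lemma inv_arc_preserving : arc_preserving (fun t : R => t^-1).
Proof.
suff inv_itv A : is_interval A -> exists2 A', arc A' & exists s : seq R,
    forall t, t \notin s -> A' t <-> A t^-1.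
  move=> A [/inv_itv//|/inv_itv[A' aA' [s hs]]].
  exists (~` A'); first exact: arcC.
  exists s => t /hs h; split; first by move=> nA; apply: contrapT => /h.
  by move=> At /h.
move=> iA; have [A0|A0] := pselect (A 0).
  (* As [0^-1 = 0] lies in [A], the complement of the preimage has a hole at 0, which is filled
     here. *)
  pose W : set R := [set t | ~ A t^-1 \/ t = 0].
  exists (~` W); last first.
    exists [:: 0] => t; rewrite inE => /eqP t0; split.
      by move=> nW; apply: contrapT => nA; apply: nW; left.
    by move=> At [].
  right; rewrite setCK; apply/is_intervalPlt => x y Wx Wy z /andP[xz zy].
  have [z0|z0|->] := ltgtP z 0; last by right.
    case: Wx => [nA|x0]; last by move: xz; rewrite x0 ltNge ltW.
    left=> Az; apply: nA; apply: (iA z^-1 0) => //.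
    have x0 : x < 0 by exact: lt_trans z0.
    by rewrite lef_nV2 ?negrE ?invr_le0 ?ltW.
  case: Wy => [nA|y0]; last by move: zy; rewrite y0 ltNge ltW.
  left=> Az; apply: nA; apply: (iA 0 z^-1) => //.
  have y0 : 0 < y by exact: lt_trans zy.
  by rewrite lef_pV2 ?posrE ?invr_ge0 ?ltW.
exists [set t | A t^-1]; last by exists [::].
left; apply/is_intervalPlt => x y /= Ax Ay z /andP[xz zy].
have [x0|x0|x0] := ltgtP x 0; last by move: Ax; rewrite x0 invr0.
  have [y0|y0|y0] := ltgtP y 0; last by move: Ay; rewrite y0 invr0.
    have z0 : z < 0 by exact: lt_trans y0.
    by apply: (iA y^-1 x^-1) => //; rewrite !lef_nV2 ?negrE ?ltW.
  by case: A0; apply: (iA x^-1 y^-1) => //; rewrite invr_le0 invr_ge0 !ltW.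
have z0 : 0 < z by exact: lt_trans xz.
have y0 : 0 < y by exact: lt_trans zy.
by apply: (iA y^-1 x^-1) => //; rewrite !lef_pV2 ?posrE ?ltW.
Qed.

Lemma affine_homeomorphism (a b : R) : a != 0 -> homeomorphism (fun t => a * t + b).
Proof.
move=> a0; exists (fun t => (t - b) / a); split; [|split; [|split]].
- by move=> t; rewrite addrK mulrC mulKf.
- by move=> t; rewrite mulrC divfK// subrK.
- move=> t; apply: (@cvgD _ R^o); last exact: cvg_cst.
  by apply: cvgM; [exact: cvg_cst|exact: cvg_id].
- move=> t; apply: cvgM; last exact: cvg_cst.
  by apply: (@cvgB _ R^o); [exact: cvg_id|exact: cvg_cst].
Qed.

Lemma homeomorphism_comp (g h : R -> R) :
  homeomorphism g -> homeomorphism h -> homeomorphism (g \o h).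
Proof.
move=> [g' [g1 [g2 [g3 g4]]]] [h' [h1 [h2 [h3 h4]]]]; exists (h' \o g').
split; [exact: can_comp|split; [exact: can_comp|split]].
  by move=> t; apply: continuous_comp; [exact: h3|exact: g3].
by move=> t; apply: continuous_comp; [exact: g4|exact: h4].
Qed.

Lemma homeomorphism_bij (g : R -> R) : homeomorphism g ->
  exists h, arc_bijection g h.
Proof. by move=> [h [? [? [? ?]]]]; exists h; exact: homeomorphism_arc_bijection. Qed.

Lemma r_arc_bijection (x : option R) : exists r', arc_bijection (r_ x) r'.
Proof.
have inv : arc_bijection (fun t : R => t^-1) (fun t => t^-1).
  by split; [exact: invrK|exact: invrK|exact: inv_arc_preserving|exact: inv_arc_preserving].
case: x => [a|]; last first.
  exists id; apply: homeomorphism_arc_bijection => //; move=> t; exact: cvg_id.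
have [h hE] := homeomorphism_bij (affine_homeomorphism (- a) (oner_neq0 R)).
exists (h \o (fun t => t^-1)).
have -> : r_ (Some a) = (fun t : R => t^-1) \o (fun t => 1 * t - a).
  by apply/funext => t; rewrite /= mul1r.
exact: arc_bijection_comp.
Qed.

Lemma gr_arc_bijection (g : R -> R) x : homeomorphism g ->
  exists T', arc_bijection (g \o r_ x) T'.
Proof.
move=> /homeomorphism_bij[h hg]; have [r' hr] := r_arc_bijection x.
by exists (r' \o h); exact: arc_bijection_comp.
Qed.

Lemma arc_bijectionC T T' : arc_bijection T T' -> arc_bijection T' T.
Proof. by case. Qed.

(** Preimages of intervals are arcs off a finite set, so push-forward does not increase the
    distance. This holds for [T] and for [T'], and mutually inverse contractions are isometries. *)
Lemma arc_bijection_push T T' : arc_bijection T T' ->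
  exists F : Pc R -> Pc R,
    [/\ forall mu A, (F mu : probability R R) A = (mu : probability R R) (T @^-1` A),
        surjective_Pc F & Ku_isometry F].
Proof.
have push U U' : arc_bijection U U' -> exists2 F : Pc R -> Pc R,
    forall mu A, (F mu : probability R R) A = (mu : probability R R) (U @^-1` A) &
    forall mu nu, d_Ku (F mu) (F nu) <= d_Ku mu nu.
  move=> [UK _ pU _]; have mU := arc_preserving_measurable pU.
  have [F FE] := Pc_push mU (can_inj UK); exists F => // mu nu.
  apply: d_Ku_le.
    have := @d_Ku_ge R mu nu _ (arc_itv `]0, 1]); exact: le_trans.
  move=> s t st; have [A aA [l hl]] := pU _ (arc_itv `]s, t]).
  have mA := arc_measurable aA.
  have mUi : measurable (U @^-1` `]s, t]%classic).
    by rewrite -[X in measurable X]setTI; apply: mU.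
  have E m : prb (F m) `]s, t]%classic = prb m A.
    by rewrite /prb FE -/(prb m _); apply: (prb_eq_off m mUi mA (s := l)) => x /hl[].
  by rewrite !E; exact: d_Ku_ge.
move=> bT; have [F FE Fd] := push _ _ bT.
have [G GE Gd] := push _ _ (arc_bijectionC bT).
have [TK T'K _ _] := bT.
have FG mu : F (G mu) = mu.
  apply: Pc_ext => A; rewrite FE GE; congr (_ _); apply/seteqP.
  by split => t /=; rewrite T'K.
have GF mu : G (F mu) = mu.
  apply: Pc_ext => A; rewrite GE FE; congr (_ _); apply/seteqP.
  by split => t /=; rewrite TK.
exists F; split=> // [nu|mu nu]; first by exists (G nu).
by apply/eqP; rewrite eq_le Fd /= -{1}(GF mu) -{1}(GF nu) Gd.
Qed.

Lemma comp_setE (g : R -> R) x T' B : arc_bijection (g \o r_ x) T' ->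
  comp_set g x B = T' @^-1` (B `&` dom_r x).
Proof.
move=> [TK T'K _ _]; apply/seteqP; split => t.
  by move=> [u [Bu du] <-] /=; move: (TK u) => /= ->.
by move=> /= [Bt dt]; exists (T' t) => //; exact: T'K.
Qed.

(** Leaving the pole out of the domain removes at most one point from the image, namely its value
    under the total map. *)
Lemma prb_comp_set (g : R -> R) x T' mu B : arc_bijection (g \o r_ x) T' ->
  measurable B -> (mu : probability R R) (comp_set g x B) =
    (mu : probability R R) (T' @^-1` B).
Proof.
move=> bT mB; rewrite (comp_setE _ bT).
have mT' := arc_preserving_measurable (let: And4 _ _ _ p := bT in p).
have md : measurable (dom_r x).
  by case: x {bT mT'} => [a|] //=; apply: measurableC.
have mp C : measurable C -> measurable (T' @^-1` C).
  by move=> mC; rewrite -[X in measurable X]setTI; exact: mT'.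
rewrite !prbE; [|exact: mp|by apply: mp; exact: measurableI]; congr (_%:E).
case: bT => TK T'K _ _.
apply: (@prb_eq_off R (if x is Some a then [:: g (r_ x a)] else [::])).
- by apply: mp; exact: measurableI.
- exact: mp.
case: x {md} TK T'K => [a|] TK T'K t /=; last by move=> _; split=> [[]|].
rewrite inE => ta; split=> [[]//|Bt]; split=> // e; case/eqP: ta.
by rewrite -(T'K t) e.
Qed.

Lemma comp_map_isometry (g : R -> R) x : homeomorphism g ->
  exists phi : Pc R -> Pc R,
    is_comp_map phi g x /\ surjective_Pc phi /\ Ku_isometry phi.
Proof.
move=> hg; have [T' bT] := gr_arc_bijection x hg.
have [F [FE sF iF]] := arc_bijection_push (arc_bijectionC bT).
by exists F; split=> // mu B mB; rewrite FE (prb_comp_set _ bT).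
Qed.

End ArcPreserving.

(** * Reconstruction of the homeomorphism *)

Section Endgame.
Variable R : realType.
Implicit Types (mu nu : Pc R) (A B C : set R) (phi : Pc R -> Pc R).

Definition ray (c : R) : set R := `]-oo, c]%classic.

Lemma ray_measurable c : measurable (ray c).
Proof. exact: measurable_itv. Qed.
#[local] Hint Resolve ray_measurable : core.

Lemma Pc_supported_on s t : s < t -> exists mu, prb mu `]s, t]%classic = 1.
Proof.
move=> st; have [lam fl] := Pc_full_support R.
have mI : measurable (`]s, t]%classic : set R) by [].
have [mu muE] := Pc_cond mI (fl _ _ st); exists mu.
by rewrite muE// setIid divff// gt_eqF// fl.
Qed.

Lemma prb_supset s t mu C : measurable C -> prb mu `]s, t]%classic = 1 ->
  (forall x, s < x <= t -> C x) -> prb mu C = 1.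
Proof.
move=> mC m1 h; have sub : `]s, t]%classic `<=` C.
  by move=> x; rewrite /= in_itv /=; exact: h.
by apply/eqP; rewrite eq_le prb_le1//= -m1 prb_le.
Qed.

Lemma prb_disjoint s t mu C : measurable C -> prb mu `]s, t]%classic = 1 ->
  (forall x, s < x <= t -> ~ C x) -> prb mu C = 0.
Proof.
move=> mC m1 h; have := prb_supset (measurableC mC) m1 h.
by rewrite prbC//; lra.
Qed.

Lemma arc_meets s t E mu : measurable E -> prb mu `]s, t]%classic = 1 ->
  0 < prb mu E -> exists2 x, s < x <= t & E x.
Proof.
move=> mE m1 E1; apply: contrapT => h; move: E1; rewrite (prb_disjoint mE m1) ?ltxx//.
by move=> x xst Ex; apply: h; exists x.
Qed.

(* Four consecutive intervals lying alternately inside and outside of [E]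
   prevent [E] from being an arc. *)
Lemma arc_not_alternating E (f : Pc R -> R) s1 t1 s2 t2 s3 t3 s4 t4 :
  arc E -> (forall nu, prb nu E = f nu) ->
  [/\ s1 < t1, s2 < t2, s3 < t3 & s4 < t4] -> [/\ t1 <= s2, t2 <= s3 & t3 <= s4] ->
  (forall nu, prb nu `]s1, t1]%classic = 1 -> f nu = 0) ->
  (forall nu, prb nu `]s2, t2]%classic = 1 -> f nu = 1) ->
  (forall nu, prb nu `]s3, t3]%classic = 1 -> f nu = 0) ->
  (forall nu, prb nu `]s4, t4]%classic = 1 -> f nu = 1) -> False.
Proof.
move=> aE Ef [l1 l2 l3 l4] [t1s2 t2s3 t3s4] h1 h2 h3 h4.
have mE := arc_measurable aE; have mCE := measurableC mE.
have out s t : s < t -> (forall nu, prb nu `]s, t]%classic = 1 -> f nu = 0) ->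
    exists2 x, s < x <= t & ~ E x.
  move=> st h; have [nu n1] := Pc_supported_on st.
  by apply: (@arc_meets s t (~` E) nu) => //; rewrite prbC// Ef h// subr0.
have inn s t : s < t -> (forall nu, prb nu `]s, t]%classic = 1 -> f nu = 1) ->
    exists2 x, s < x <= t & E x.
  move=> st h; have [nu n1] := Pc_supported_on st.
  by apply: (@arc_meets s t E nu) => //; rewrite Ef h.
have [x1 /andP[_ x1t] nE1] := out _ _ l1 h1.
have [x2 /andP[sx2 x2t] E2] := inn _ _ l2 h2.
have [x3 /andP[sx3 x3t] nE3] := out _ _ l3 h3.
have [x4 /andP[sx4 _] E4] := inn _ _ l4 h4.
case: aE => iE.
  by apply: nE3; apply: (iE x2 x4) => //; apply/andP; split; lra.
by apply: (iE x1 x3) E2 => //; apply/andP; split; lra.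
Qed.

Lemma arc_not_alternating' E (f : Pc R -> R) s1 t1 s2 t2 s3 t3 s4 t4 :
  arc E -> (forall nu, prb nu E = f nu) ->
  [/\ s1 < t1, s2 < t2, s3 < t3 & s4 < t4] -> [/\ t1 <= s2, t2 <= s3 & t3 <= s4] ->
  (forall nu, prb nu `]s1, t1]%classic = 1 -> f nu = 1) ->
  (forall nu, prb nu `]s2, t2]%classic = 1 -> f nu = 0) ->
  (forall nu, prb nu `]s3, t3]%classic = 1 -> f nu = 1) ->
  (forall nu, prb nu `]s4, t4]%classic = 1 -> f nu = 0) -> False.
Proof.
move=> aE Ef l t h1 h2 h3 h4; have mE := arc_measurable aE.
apply: (@arc_not_alternating (~` E) (fun nu => 1 - f nu) s1 t1 s2 t2 s3 t3 s4 t4) => //.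
- exact: arcC.
- by move=> nu; rewrite prbC// Ef.
- by move=> nu /h1 ->; rewrite subrr.
- by move=> nu /h2 ->; rewrite subr0.
- by move=> nu /h3 ->; rewrite subrr.
- by move=> nu /h4 ->; rewrite subr0.
Qed.

Definition prb_equiv A B := forall nu, prb nu A = prb nu B.

(** Up to null sets an arc is determined by its two endpoints on the circle; the condition on [mu]
    excludes coinciding endpoints and the whole line. *)
Lemma arc_cases B : arc B -> (exists mu, 0 < prb mu B < 1) ->
  [\/ exists c, prb_equiv B (ray c), exists c, prb_equiv B (~` ray c),
      exists a b, a < b /\ prb_equiv B `]a, b]%classic |
      exists a b, a < b /\ prb_equiv B (~` `]a, b]%classic)].
Proof.
have key A : is_interval A -> (exists mu, 0 < prb mu A < 1) ->
  [\/ exists c, prb_equiv A (ray c), exists c, prb_equiv A (~` ray c) |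
      exists a b, a < b /\ prb_equiv A `]a, b]%classic].
  move=> iA [mu muA]; have mA := is_interval_measurable iA.
  have [a [b [ab [s hs]]]] := interval_oc iA.
  have e nu : prb nu A = ecdf nu b - ecdf nu a.
    by rewrite (prb_eq_off nu mA (oc_measurable a b) hs) prb_oc.
  have nab : a != b.
    by apply: contraTneq muA => ab'; rewrite e ab' subrr ltxx.
  case: a ab nab e {hs} => [a| |] ab nab e.
  - case: b ab nab e => [b| |] // ab nab e.
      apply: Or33; exists a, b; have lab : a < b.
        by rewrite lt_neqAle -lee_fin ab andbT; apply: contra nab => /eqP ->.
      by split=> // nu; rewrite e distrf_itv ?(ltW lab)// !ecdf_fin.
    apply: Or32; exists a => nu; rewrite e ecdf_y ecdf_fin prbC//.
  - by case: b ab nab e.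
  - case: b ab nab e => [b| |] // ab nab e.
      by apply: Or31; exists b => nu; rewrite e ecdf_Ny ecdf_fin subr0.
    by exfalso; move: muA; rewrite e ecdf_y ecdf_Ny subr0 ltxx andbF.
move=> aB hB; have mB := arc_measurable aB; case: aB => iB.
  case: (key _ iB hB) => [h|h|h]; [exact: Or41|exact: Or42|exact: Or43].
have hC : exists mu, 0 < prb mu (~` B) < 1.
  move: hB => [mu /andP[m0 m1]]; exists mu; rewrite prbC//; apply/andP; split; lra.
have sw C nu : measurable C -> prb_equiv (~` B) C -> prb nu B = prb nu (~` C).
  by move=> mC h; rewrite [RHS]prbC// -h prbC//; ring.
case: (key _ iB hC) => [[c h]|[c h]|[a [b [ab h]]]].
- by apply: Or42; exists c => nu; exact: sw.
- apply: Or41; exists c => nu; rewrite (sw (~` ray c))// ?setCK//.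
  exact: measurableC.
- by apply: Or44; exists a, b; split=> // nu; exact: sw.
Qed.

Lemma increasing_homeomorphism (k : R -> R) :
  {homo k : s t / s < t} -> (forall u, exists t, k t = u) ->
  exists2 g : R -> R, homeomorphism g & cancel k g /\ {mono g : s t / s <= t}.
Proof.
move=> kinc /choice[g gK].
have kmono : {mono k : s t / s <= t} by exact: le_mono.
have kI : injective k by exact: inc_inj.
have kK : cancel k g by move=> t; apply: kI.
have gmono : {mono g : s t / s <= t} by move=> s t; rewrite -kmono !gK.
have cont (u v : R -> R) : cancel u v -> cancel v u -> {mono u : s t / s <= t} ->
    {mono v : s t / s <= t} -> continuous u.
  move=> uK vK um vm t; apply/cvgrPdist_lt => e e0.
  have lu := leW_mono um; have lv := leW_mono vm.
  have h1 : v (u t - e) < t by rewrite -{2}(uK t) lv; lra.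
  have h2 : t < v (u t + e) by rewrite -{1}(uK t) lv; lra.
  near=> x.
  have x1 : v (u t - e) < x by near: x; exact: lt_nbhsr.
  have x2 : x < v (u t + e) by near: x; exact: lt_nbhsl.
  move: x1 x2; rewrite -lu vK -(lu x) vK => x1 x2.
  by rewrite ltr_norml; apply/andP; split; lra.
exists g; last by split.
exists k; split=> //; split=> //; split.
  exact: (cont g k).
exact: (cont k g).
Unshelve. all: by end_near.
Qed.

(** That is, [mu] is the push-forward of [phi mu] under [T]; preimages avoid the domain of
    [r_ x]. *)
Definition induced phi (T : R -> R) := forall mu A, measurable A ->
  prb mu A = prb (phi mu) (T @^-1` A).

(** The homeomorphism is the inverse of [k]. Measures on []s, t]] show that [k] is strictly
    increasing. To reach [u], take [mu] with [phi mu] of full support and solve for [t] by the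
    intermediate value theorem; full support forces [k t = u]. *)
Lemma ray_map_induced phi (k : R -> R) : surjective_Pc phi ->
  (forall mu t, prb (phi mu) (ray (k t)) = prb mu (ray t)) ->
  exists2 g, homeomorphism g & induced phi g.
Proof.
move=> sphi hk; have [lam fl] := Pc_full_support R; have [mu muE] := sphi lam.
have [||g hg [kK gm]] := @increasing_homeomorphism k.
- move=> s t st; rewrite ltNge; apply/negP => kts.
  have [rho r1] := Pc_supported_on st.
  have := distrf_le (phi rho) kts; rewrite /distrf -!/(prb _ (ray _)) !hk.
  rewrite -[prb rho (ray s)]/(distrf rho s) -[prb rho (ray t)]/(distrf rho t).
  by rewrite distrf_itv ?(ltW st)// in r1; lra.
- move=> u; have ll s t : s < t -> distrf lam s < distrf lam t.
    by move=> st; rewrite -subr_gt0 -distrf_itv ?(ltW st)// fl.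
  have u0 : 0 < distrf lam u.
    by apply: le_lt_trans (ll (u - 1) u _); [exact: distrf_ge0|lra].
  have u1 : 0 < 1 - distrf lam u.
    by rewrite subr_gt0; apply: lt_le_trans (ll u (u + 1) _) _; [lra|exact: distrf_le1].
  have [a ha] := distrf_small mu u0; have [b hb] := distrf_big mu u1.
  have ab : a <= b.
    rewrite leNgt; apply/negP => ba.
    by have := distrf_le mu (ltW ba); lra.
  have [|t _ tE] := IVT ab (continuous_subspaceT (@distrf_continuous R mu)) (v := distrf lam u).
    rewrite ge_min le_max; apply/andP; split; apply/orP; [left|right]; lra.
  exists t; have e : distrf lam (k t) = distrf lam u.
    by rewrite -tE -muE; exact: hk.
  have [/ll|/ll|//] := ltgtP (k t) u; rewrite e ltxx//.
exists g => // rho A mA.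
have [h bgh] := homeomorphism_bij hg.
have [F [FE _ _]] := arc_bijection_push bgh.
suff : (rho : probability R R) A = (F (phi rho) : probability R R) A.
  by rewrite FE /prb => ->.
apply: distrf_unique => // t; rewrite FE.
have -> : g @^-1` `]-oo, t]%classic = ray (k t).
  have e x : (g x <= t) = (x <= k t) by rewrite -{1}(kK t) gm.
  by apply/seteqP; split => x; rewrite /ray /= !in_itv /= e.
by rewrite (prbE rho)// (prbE (phi rho))// hk.
Qed.

End Endgame.

(** * Images of the rays when one of them is a ray *)

Section Chain.
Variable R : realType.
Implicit Types (mu nu : Pc R) (A B C : set R).
Variable phi : Pc R -> Pc R.
Hypothesis sphi : surjective_Pc phi.
Hypothesis aphi : arc_map phi.

Let image_ray t C := forall mu, prb (phi mu) C = prb mu (ray t).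

Lemma itv_nontrivial (a b : R) : a < b ->
  (exists mu, 0 < prb mu (ray a) < 1) /\ (exists mu, 0 < prb mu `]a, b]%classic < 1).
Proof.
move=> ab; have [lam fl] := Pc_full_support R.
have ll s t : s < t -> distrf lam s < distrf lam t.
  by move=> st; rewrite -subr_gt0 -distrf_itv ?(ltW st)// fl.
have h1 := ll (a - 1) a; have h2 := ll a b ab; have h3 := ll b (b + 1).
have h4 := distrf_ge0 lam (a - 1); have h5 := distrf_le1 lam (b + 1).
split; exists lam; first rewrite -[prb lam (ray a)]/(distrf lam a).
  by apply/andP; split; lra.
by rewrite distrf_itv ?(ltW ab)//; apply/andP; split; lra.
Qed.

Lemma image_ray_cases t :
  [\/ exists c, image_ray t (ray c), exists c, image_ray t (~` ray c),
      exists a b, a < b /\ image_ray t `]a, b]%classic |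
      exists a b, a < b /\ image_ray t (~` `]a, b]%classic)].
Proof.
have [[mu muE] _] := @itv_nontrivial t (t + 1) ltac:(lra).
have [B [aB BE]] := aphi (arc_itv `]-oo, t]) (ex_intro _ mu muE).
have [|[c h]|[c h]|[a [b [ab h]]]|[a [b [ab h]]]] := arc_cases aB.
- by exists (phi mu); rewrite BE.
- by apply: Or41; exists c => nu; rewrite -h BE.
- by apply: Or42; exists c => nu; rewrite -h BE.
- by apply: Or43; exists a, b; split=> // nu; rewrite -h BE.
- by apply: Or44; exists a, b; split=> // nu; rewrite -h BE.
Qed.

(** As []s, t]] is an arc too, it has an image, whose measure is the difference; surjectivity
    extends the identity to every [nu]. This constraint, with its positivity, rules out all bad
    configurations below. *)
Lemma image_diff s t C D : s < t -> image_ray s C -> image_ray t D ->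
  exists2 E, arc E & forall nu, prb nu E = prb nu D - prb nu C.
Proof.
move=> st hC hD; have [_ [mu muE]] := itv_nontrivial st.
have [E [aE EE]] := aphi (arc_itv `]s, t]) (ex_intro _ mu muE).
exists E => // nu; have [rho <-] := sphi nu.
by rewrite EE hC hD distrf_itv ?(ltW st).
Qed.

Lemma image_diff_ge0 s t C D nu : s < t -> image_ray s C -> image_ray t D ->
  prb nu C <= prb nu D.
Proof.
move=> st hC hD; have [E _ EE] := image_diff st hC hD.
by rewrite -subr_ge0 -EE prb_ge0.
Qed.

Lemma image_diff_neq s t C : s < t -> image_ray s C -> ~ image_ray t C.
Proof.
move=> st hC hD; have [rho r1] := Pc_supported_on st.
move: r1; rewrite distrf_itv ?(ltW st)// -[distrf _ _]/(prb rho (ray t)).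
by rewrite -[distrf _ _]/(prb rho (ray s)) -hC -hD; lra.
Qed.

Variable c : R.
Hypothesis phi0 : image_ray 0 (ray c).

(** These evaluate a measure carried by an interval on a set containing, respectively missing, that
    interval. *)
Ltac one H := (apply: (prb_supset _ H) => [|x];
  [by do ?[exact: ray_measurable|exact: measurable_itv|apply: measurableC]
  |by rewrite /ray /= ?in_itv /=; lra]).
Ltac zero H := (apply: (prb_disjoint _ H) => [|x];
  [by do ?[exact: ray_measurable|exact: measurable_itv|apply: measurableC]
  |by rewrite /ray /= ?in_itv /=; lra]).

(** The image contains [ray c] up to null sets, which excludes arcs missing part of it. If it shared
    neither endpoint, c or oo, with [ray c], the difference would have two components. *)
Lemma image_ray_pos t : 0 < t ->
  (exists2 u, c < u & image_ray t (ray u)) \/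
  (exists2 b, c < b & image_ray t (~` `]c, b]%classic)).
Proof.
move=> t0; have [[u h]|[u h]|[a [b [ab h]]]|[a [b [ab h]]]] := image_ray_cases t.
- left; exists u => //; have [//|uc|uc] := ltgtP c u.
    have [nu n1] := Pc_supported_on uc; have := image_diff_ge0 nu t0 phi0 h.
    have -> : prb nu (ray c) = 1 by one n1.
    have -> : prb nu (ray u) = 0 by zero n1.
    by rewrite ler10.
  by case: (image_diff_neq t0 phi0); rewrite uc.
- exfalso; have [m [mc mu]] : exists m, m <= c /\ m <= u.
    by exists (Num.min c u); rewrite !ge_min !lexx orbT.
  have [nu n1] := @Pc_supported_on R (m - 1) m ltac:(lra).
  have := image_diff_ge0 nu t0 phi0 h.
  have -> : prb nu (ray c) = 1 by one n1.
  have -> : prb nu (~` ray u) = 0 by zero n1.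
  by rewrite ler10.
- exfalso; have [m [mc ma]] : exists m, m <= c /\ m <= a.
    by exists (Num.min c a); rewrite !ge_min !lexx orbT.
  have [nu n1] := @Pc_supported_on R (m - 1) m ltac:(lra).
  have := image_diff_ge0 nu t0 phi0 h.
  have -> : prb nu (ray c) = 1 by one n1.
  have -> : prb nu `]a, b]%classic = 0 by zero n1.
  by rewrite ler10.
right; have [ac|ca|ac] := ltgtP a c; last first.
- by exists b; rewrite -?ac.
- exfalso; have [E aE EE] := image_diff t0 phi0 h.
  apply: (@arc_not_alternating _ _ _ (c - 1) c c a a b b (b + 1) aE EE).
  + by split; lra.
  + by split; lra.
  + move=> nu n1; have -> : prb nu (ray c) = 1 by one n1.
    have -> : prb nu (~` `]a, b]%classic) = 1 by one n1.
    by rewrite subrr.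
  + move=> nu n1; have -> : prb nu (ray c) = 0 by zero n1.
    have -> : prb nu (~` `]a, b]%classic) = 1 by one n1.
    by rewrite subr0.
  + move=> nu n1; have -> : prb nu (ray c) = 0 by zero n1.
    have -> : prb nu (~` `]a, b]%classic) = 0 by zero n1.
    by rewrite subr0.
  + move=> nu n1; have -> : prb nu (ray c) = 0 by zero n1.
    have -> : prb nu (~` `]a, b]%classic) = 1 by one n1.
    by rewrite subr0.
- exfalso; have [m [am mc mb]] : exists m, [/\ a < m, m <= c & m <= b].
    by exists (Num.min c b); rewrite lt_min !ge_min !lexx orbT ac ab.
  have [nu n1] := Pc_supported_on am.
  have := image_diff_ge0 nu t0 phi0 h.
  have -> : prb nu (ray c) = 1 by one n1.
  have -> : prb nu (~` `]a, b]%classic) = 0 by zero n1.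
  by rewrite ler10.
Qed.

(** Dual to [image_ray_pos]: the image now lies inside [ray c]. *)
Lemma image_ray_neg s : s < 0 ->
  (exists2 u, u < c & image_ray s (ray u)) \/
  (exists2 a, a < c & image_ray s `]a, c]%classic).
Proof.
move=> s0; have [[u h]|[u h]|[a [b [ab h]]]|[a [b [ab h]]]] := image_ray_cases s.
- left; exists u => //; have [//|cu|uc] := ltgtP u c.
    have [nu n1] := Pc_supported_on cu; have := image_diff_ge0 nu s0 h phi0.
    have -> : prb nu (ray c) = 0 by zero n1.
    have -> : prb nu (ray u) = 1 by one n1.
    by rewrite ler10.
  by case: (image_diff_neq s0 h); rewrite uc.
- exfalso; have [m [cm um]] : exists m, c <= m /\ u <= m.
    by exists (Num.max c u); rewrite !le_max !lexx orbT.
  have [nu n1] := @Pc_supported_on R m (m + 1) ltac:(lra).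
  have := image_diff_ge0 nu s0 h phi0.
  have -> : prb nu (ray c) = 0 by zero n1.
  have -> : prb nu (~` ray u) = 1 by one n1.
  by rewrite ler10.
- right; have [bc|cb|bc] := ltgtP b c; last first.
  + by exists a; rewrite -?bc.
  + exfalso; have [m [cm am mb]] : exists m, [/\ c <= m, a <= m & m < b].
      by exists (Num.max c a); rewrite gt_max !le_max !lexx orbT cb ab.
    have [nu n1] := Pc_supported_on mb.
    have := image_diff_ge0 nu s0 h phi0.
    have -> : prb nu (ray c) = 0 by zero n1.
    have -> : prb nu `]a, b]%classic = 1 by one n1.
    by rewrite ler10.
  + exfalso; have [E aE EE] := image_diff s0 h phi0.
    apply: (@arc_not_alternating' _ _ _ (a - 1) a a b b c c (c + 1) aE EE).
    * by split; lra.
    * by split; lra.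
    * move=> nu n1; have -> : prb nu (ray c) = 1 by one n1.
      have -> : prb nu `]a, b]%classic = 0 by zero n1.
      by rewrite subr0.
    * move=> nu n1; have -> : prb nu (ray c) = 1 by one n1.
      have -> : prb nu `]a, b]%classic = 1 by one n1.
      by rewrite subrr.
    * move=> nu n1; have -> : prb nu (ray c) = 1 by one n1.
      have -> : prb nu `]a, b]%classic = 0 by zero n1.
      by rewrite subr0.
    * move=> nu n1; have -> : prb nu (ray c) = 0 by zero n1.
      have -> : prb nu `]a, b]%classic = 0 by zero n1.
      by rewrite subr0.
- exfalso; have [m [cm bm]] : exists m, c <= m /\ b <= m.
    by exists (Num.max c b); rewrite !le_max !lexx orbT.
  have [nu n1] := @Pc_supported_on R m (m + 1) ltac:(lra).
  have := image_diff_ge0 nu s0 h phi0.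
  have -> : prb nu (ray c) = 0 by zero n1.
  have -> : prb nu (~` `]a, b]%classic) = 1 by one n1.
  by rewrite ler10.
Qed.

(** The difference would consist of []u, c]] and the part beyond [b]. *)
Lemma image_ray_mixed s t u b : s < t -> u < c -> c < b ->
  image_ray s (ray u) -> image_ray t (~` `]c, b]%classic) -> False.
Proof.
move=> st uc cb hs ht; have [E aE EE] := image_diff st hs ht.
apply: (@arc_not_alternating _ _ _ (u - 1) u u c c b b (b + 1) aE EE).
- by split; lra.
- by split; lra.
- move=> nu n1; have -> : prb nu (ray u) = 1 by one n1.
  have -> : prb nu (~` `]c, b]%classic) = 1 by one n1.
  by rewrite subrr.
- move=> nu n1; have -> : prb nu (ray u) = 0 by zero n1.
  have -> : prb nu (~` `]c, b]%classic) = 1 by one n1.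
  by rewrite subr0.
- move=> nu n1; have -> : prb nu (ray u) = 0 by zero n1.
  have -> : prb nu (~` `]c, b]%classic) = 0 by zero n1.
  by rewrite subr0.
- move=> nu n1; have -> : prb nu (ray u) = 0 by zero n1.
  have -> : prb nu (~` `]c, b]%classic) = 1 by one n1.
  by rewrite subr0.
Qed.

(** The difference would consist of the part up to [a] and []c, u]]. *)
Lemma image_ray_mixed' s t a u : s < t -> a < c -> c < u ->
  image_ray s `]a, c]%classic -> image_ray t (ray u) -> False.
Proof.
move=> st ac cu hs ht; have [E aE EE] := image_diff st hs ht.
apply: (@arc_not_alternating' _ _ _ (a - 1) a a c c u u (u + 1) aE EE).
- by split; lra.
- by split; lra.
- move=> nu n1; have -> : prb nu (ray u) = 1 by one n1.
  have -> : prb nu `]a, c]%classic = 0 by zero n1.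
  by rewrite subr0.
- move=> nu n1; have -> : prb nu (ray u) = 1 by one n1.
  have -> : prb nu `]a, c]%classic = 1 by one n1.
  by rewrite subrr.
- move=> nu n1; have -> : prb nu (ray u) = 1 by one n1.
  have -> : prb nu `]a, c]%classic = 0 by zero n1.
  by rewrite subr0.
- move=> nu n1; have -> : prb nu (ray u) = 0 by zero n1.
  have -> : prb nu `]a, c]%classic = 0 by zero n1.
  by rewrite subr0.
Qed.

(** Opposite sides of 0 must keep the same endpoint fixed: the type at -1 dictates that of every
    positive [t], and the type at 1 that of every negative one. *)
Lemma image_ray_types :
  (forall t, exists u, image_ray t (ray u)) \/
  [/\ forall s, s < 0 -> exists2 a, a < c & image_ray s `]a, c]%classic &
      forall t, 0 < t -> exists2 b, c < b & image_ray t (~` `]c, b]%classic)].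
Proof.
have [[u1 u1c h1]|[a1 a1c h1]] := @image_ray_neg (-1) ltac:(lra).
  have pos t : 0 < t -> exists2 u, c < u & image_ray t (ray u).
    move=> t0; have [//|[b cb hb]] := image_ray_pos t0.
    by case: (@image_ray_mixed (-1) t u1 b) => //; lra.
  have [u2 cu2 h2] := pos 1 ltr01.
  left=> t; have [t0|t0|->] := ltgtP t 0; last by exists c.
    have [[u _ hu]|[a ac ha]] := image_ray_neg t0; first by exists u.
    by case: (@image_ray_mixed' t 1 a u2) => //; lra.
  by have [u _ hu] := pos t t0; exists u.
have pos t : 0 < t -> exists2 b, c < b & image_ray t (~` `]c, b]%classic).
  move=> t0; have [[u cu hu]|//] := image_ray_pos t0.
  by case: (@image_ray_mixed' (-1) t a1 u) => //; lra.
have [b2 cb2 h2] := pos 1 ltr01.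
right; split=> // s s0; have [[u uc hu]|//] := image_ray_neg s0.
by case: (@image_ray_mixed s 1 u b2) => //; lra.
Qed.

End Chain.

(** * Moebius normalization and the final form *)

Section Reconstruction.
Variable R : realType.
Implicit Types (mu nu : Pc R) (A B C : set R) (phi : Pc R -> Pc R).

Lemma itv_inv_le (a b t : R) : a < b ->
  ((t - a)^-1 <= (b - a)^-1) = (t <= a) || (b <= t).
Proof.
move=> ab; have ba : 0 < b - a by lra.
have [ta|at_|->] := ltgtP t a.
- have ta' : (t - a)^-1 < 0 by rewrite invr_lt0; lra.
  by rewrite (le_trans (ltW ta'))// invr_ge0 ltW.
- have ta' : 0 < t - a by lra.
  by rewrite lef_pV2 ?posrE//= lerBlDr subrK.
- by rewrite subrr invr0 invr_ge0 ltW.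
Qed.

(** The point [b] is excepted because both the ray and []a, b]] are closed on the right. The pole
    [a] fits, its value being 0. *)
Lemma ray_preimage_r_pos (a b t : R) : a < b -> t != b ->
  (r_ (Some a) @^-1` ray (b - a)^-1) t <-> (~` `]a, b]%classic) t.
Proof.
move=> ab tb; rewrite /ray /= !in_itv /= itv_inv_le//; split.
  by move=> /orP h /andP[h1 h2]; move: tb => /eqP; case: h => ? []; lra.
move=> /negP; rewrite negb_and -leNgt -ltNge => /orP[->//|/ltW ->].
by rewrite orbT.
Qed.

Lemma ray_preimage_r_neg (a c t : R) : a < c -> t \notin [:: a; c] ->
  (r_ (Some c) @^-1` ray (a - c)^-1) t <-> `]a, c]%classic t.
Proof.
move=> ac; rewrite !inE negb_or => /andP[ta tc]; rewrite /ray /= !in_itv /=.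
have e : ((t - c)^-1 <= (a - c)^-1) = ~~ ((t <= a) || (c <= t)).
  have ac' : a - c < 0 by lra.
  have [tc'|ct|tc'] := ltgtP t c; last by rewrite tc' eqxx in tc.
  - by rewrite lef_nV2 ?negrE// ?orbF ?lerBlDr ?subrK -?ltNge; [rewrite le_eqVlt eq_sym (negbTE ta)|lra].
  - rewrite orbT; apply/negbTE; rewrite -ltNge; apply: (@lt_trans _ _ 0).
      by rewrite invr_lt0.
    by rewrite invr_gt0; lra.
rewrite e negb_or -!ltNge; split=> /andP[-> h] //=; first exact: ltW.
by rewrite lt_neqAle tc h.
Qed.

Lemma ray_preimage_r0 (c t : R) :
  (r_ (Some c) @^-1` ray 0) t <-> ray c t.
Proof. by rewrite /ray /= !in_itv /= invr_le0 subr_le0. Qed.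

Lemma mobius_comp (k : R) (x y : option R) : k != 0 ->
  exists h z, homeomorphism h /\ exists s : seq R, forall t, t \notin s ->
    r_ x (k * r_ y t + 0) = h (r_ z t).
Proof.
move=> k0; case: x => [b|]; last first.
  exists (fun t => k * t + 0), y; split; first exact: affine_homeomorphism.
  by exists [::].
have ki : k^-1 != 0 by rewrite invr_neq0.
case: y => [a|]; last first.
  exists (fun t => k^-1 * t + 0), (Some (b / k)).
  split; first exact: affine_homeomorphism.
  exists [::] => t _ /=; rewrite !addr0 -invfM; congr (_^-1); by field.
have [->|b0] := eqVneq b 0.
  exists (fun t => k^-1 * t + - (a / k)), None.
  split; first exact: affine_homeomorphism.
  exists [::] => t _ /=; rewrite addr0 subr0 invfM invrK; by ring.
(* With [u = t - a], the composite is u / (k - b u) = - 1/b - (k / b^2) / (u - k/b). The formula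
   fails at the two poles, because of [0^-1 = 0]. *)
exists (fun t => - (k / b ^+ 2) * t + - b^-1), (Some (a + k / b)).
split; first by apply: affine_homeomorphism; rewrite oppr_eq0 mulf_neq0 ?invr_neq0 ?expf_neq0.
exists [:: a; a + k / b] => t; rewrite !inE negb_or => /andP[ta tb] /=.
have u0 : t - a != 0 by rewrite subr_eq0.
have d0 : k - b * (t - a) != 0.
  apply: contra tb => /eqP d0; apply/eqP.
  rewrite (_ : t = a + k / b - (k - b * (t - a)) / b); last by field.
  by rewrite d0 mul0r subr0.
rewrite (_ : t - (a + k / b) = - ((k - b * (t - a)) / b)); last by field.
rewrite addr0 (_ : k * (t - a)^-1 - b = (k - b * (t - a)) / (t - a)); last by field.
move: (t - a) u0 d0 => u u0 d0; field.
by rewrite b0 d0 u0.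
Qed.

Lemma isometry_comp phi (F : Pc R -> Pc R) :
  surjective_Pc phi -> Ku_isometry phi -> surjective_Pc F -> Ku_isometry F ->
  surjective_Pc (F \o phi) /\ Ku_isometry (F \o phi).
Proof.
move=> sphi iphi sF iF; split=> [nu|mu nu]; last by rewrite /= iF iphi.
by have [m <-] := sF nu; have [n <-] := sphi m; exists n.
Qed.

Lemma preimage_measurable T T' A : arc_bijection T T' -> measurable A ->
  measurable (T @^-1` A : set R).
Proof.
move=> [_ _ pT _] mA; rewrite -[X in measurable X]setTI.
exact: arc_preserving_measurable.
Qed.

(* The images of the arcs [[oo, t]] share an endpoint: it is [oo], or else [c],
   which [r_c] moves to [oo]. *)
Lemma induced_from_ray phi c : surjective_Pc phi -> Ku_isometry phi ->
  (forall mu, prb (phi mu) (ray c) = prb mu (ray 0)) ->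
  exists g x, homeomorphism g /\ induced phi (g \o r_ x).
Proof.
move=> sphi iphi h0; have aphi := isometry_arc_map sphi iphi.
have [/choice[k kE]|[hneg hpos]] := image_ray_types sphi aphi h0.
  have [g hg gi] := ray_map_induced sphi (fun mu t => kE t mu).
  by exists g, None.
have [T' bT] := r_arc_bijection (Some c).
have [F [FE sF iF]] := arc_bijection_push bT.
have [sF' iF'] := isometry_comp sphi iphi sF iF.
have FprbE nu A : prb (F nu) A = prb nu (r_ (Some c) @^-1` A) by rewrite /prb FE.
have mr u : measurable (r_ (Some c) @^-1` ray u).
  by apply: (preimage_measurable bT); exact: ray_measurable.
have /choice[k kE] : forall t, exists u, forall mu,
    prb ((F \o phi) mu) (ray u) = prb mu (ray t).
  move=> t; have [t0|t0|->] := ltgtP t 0.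
  - have [a ac ha] := hneg t t0; exists (a - c)^-1 => mu; rewrite /= FprbE -ha.
    by apply: prb_eq_off => // x; exact: ray_preimage_r_neg.
  - have [b cb hb] := hpos t t0; exists (b - c)^-1 => mu; rewrite /= FprbE -hb.
    apply: (@prb_eq_off _ [:: b]) => //; first exact: measurableC.
    by move=> x; rewrite inE; exact: ray_preimage_r_pos.
  - exists 0 => mu; rewrite /= FprbE -h0.
    apply: (@prb_eq_off _ [::]) => //; first exact: ray_measurable.
    by move=> x _; exact: ray_preimage_r0.
have [g hg gi] := ray_map_induced sF' (fun mu t => kE t mu).
exists g, (Some c); split=> // mu A mA.
by rewrite (gi mu A mA) /= FprbE.
Qed.

(** Following [phi] by the push-forward along [k * r_ y] reduces to [induced_from_ray];
    [mobius_comp] then merges the two inversions into one, off a finite set. *)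
Lemma induced_normalized phi (k : R) y c : k != 0 ->
  surjective_Pc phi -> Ku_isometry phi ->
  (forall mu, prb (phi mu) ((fun t => k * r_ y t + 0) @^-1` ray c) = prb mu (ray 0)) ->
  exists g x, homeomorphism g /\ induced phi (g \o r_ x).
Proof.
move=> k0 sphi iphi h0.
have [T' bT] := gr_arc_bijection y (affine_homeomorphism 0 k0).
have [F [FE sF iF]] := arc_bijection_push bT.
have [sF' iF'] := isometry_comp sphi iphi sF iF.
have [mu|g [x [hg gi]]] := @induced_from_ray (F \o phi) c sF' iF'.
  by rewrite -h0 /prb /= FE.
have [h [z [hh [s hs]]]] := mobius_comp x y k0.
exists (g \o h), z; have hgh := homeomorphism_comp hg hh; split=> // mu A mA.
rewrite gi// {1}/prb /= FE.
have [U bU] := gr_arc_bijection x hg; have [V bV] := gr_arc_bijection z hgh.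
apply: (@prb_eq_off _ s).
- by apply: (preimage_measurable bT); exact: (preimage_measurable bU).
- exact: (preimage_measurable bV).
- by move=> t ts; rewrite /= hs.
Qed.

(** Each of the four shapes of the image of [ray 0] becomes a ray: by the identity, the reflection,
    [- r_a] for []a, b]], and [r_a] for its complement. *)
Lemma isometry_induced phi : surjective_Pc phi -> Ku_isometry phi ->
  exists g x, homeomorphism g /\ induced phi (g \o r_ x).
Proof.
move=> sphi iphi; have aphi := isometry_arc_map sphi iphi.
have mT (k : R) y c : k != 0 ->
    measurable ((fun t => k * r_ y t + 0) @^-1` ray c).
  move=> k0; have [T' bT] := gr_arc_bijection y (affine_homeomorphism 0 k0).
  by apply: (preimage_measurable bT); exact: ray_measurable.
have N1 : (-1 : R) != 0 by rewrite oppr_eq0 oner_neq0.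
have I1 : (1 : R) != 0 by exact: oner_neq0.
have [[c h]|[c h]|[a [b [ab h]]]|[a [b [ab h]]]] := image_ray_cases aphi 0.
- apply: (@induced_normalized phi 1 None c I1) => // mu; rewrite -h.
  apply: (@prb_eq_off _ [::]); [exact: mT|exact: ray_measurable|].
  by move=> t _; rewrite /= mul1r addr0.
- apply: (@induced_normalized phi (-1) None (- c) N1) => // mu; rewrite -h.
  apply: (@prb_eq_off _ [:: c]); [exact: mT|apply: measurableC; exact: ray_measurable|].
  move=> t; rewrite inE => tc; rewrite /ray /= !in_itv /= mulN1r addr0 lerN2.
  split; first by move=> ct tc'; move: tc => /eqP; apply; apply/eqP; rewrite eq_le tc'.
  by move=> /negP; rewrite -ltNge => /ltW.
- apply: (@induced_normalized phi (-1) (Some a) (- (b - a)^-1) N1) => // mu; rewrite -h.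
  apply: (@prb_eq_off _ [:: a]); [exact: mT|exact: measurable_itv|].
  move=> t; rewrite inE => ta; rewrite /ray /= !in_itv /= mulN1r addr0 lerN2.
  have ba : 0 < b - a by lra.
  have [ta'|at_|ta'] := ltgtP t a; last by rewrite ta' eqxx in ta.
    have : (t - a)^-1 < 0 by rewrite invr_lt0; lra.
    have : 0 < (b - a)^-1 by rewrite invr_gt0.
    by split=> //; lra.
  have ta' : 0 < t - a by lra.
  by rewrite lef_pV2 ?posrE// lerD2r.
- apply: (@induced_normalized phi 1 (Some a) (b - a)^-1 I1) => // mu; rewrite -h.
  apply: (@prb_eq_off _ [:: b]); [exact: mT|apply: measurableC; exact: measurable_itv|].
  move=> t; rewrite inE => tb; rewrite -ray_preimage_r_pos//.
  by rewrite /ray /= mul1r addr0.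
Qed.

Lemma induced_comp_map phi g x : homeomorphism g -> induced phi (g \o r_ x) ->
  is_comp_map phi g x.
Proof.
move=> hg hi mu B mB; have [T' bT] := gr_arc_bijection x hg.
have mTB := preimage_measurable (arc_bijectionC bT) mB.
have [TK _ _ _] := bT.
have e : (g \o r_ x) @^-1` (T' @^-1` B) = B.
  by apply/seteqP; split => t /=; move: (TK t) => /= ->.
by rewrite (prb_comp_set _ bT mB) !prbE// (hi mu _ mTB) e.
Qed.

End Reconstruction.

Theorem theorem1p1 (R : realType) :
  (forall phi : Pc R -> Pc R,
      surjective_Pc phi -> Ku_isometry phi ->
      exists (g : R -> R) (x : option R), homeomorphism g /\ is_comp_map phi g x)
  /\
  (forall (g : R -> R) (x : option R), homeomorphism g ->
      exists phi : Pc R -> Pc R,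
        is_comp_map phi g x /\ surjective_Pc phi /\ Ku_isometry phi).
Proof.
split=> [phi sphi iphi|g x]; last exact: comp_map_isometry.
have [g [x [hg gi]]] := isometry_induced sphi iphi.
by exists g, x; split=> //; exact: induced_comp_map.
Qed.
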